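(* Let $r\ge3$, $a\ge2$, $1\le t\le r-1$ be fixed integers and let $p>1$ be a fixed real number. Then, for all sufficiently large $n$, every $P_{2a+1}^r$-free family $\mathcal{H}\subseteq\binom{[n]}{r}$ satisfies $$\left\|\mathcal{H}\right\|_{t,p}\le \left\|\mathcal{H}_{n,r,a}\right\|_{t,p}.$$ Equality holds if and only if $\mathcal{H}$ is isomorphic to $\mathcal{H}_{n,r,a}$.
   Context: $[n]=\{1,\dots,n\}$ and $\binom{[n]}{r}$ is the collection of all $r$-subsets of $[n]$. For a family $\mathcal{H}\subseteq\binom{[n]}{r}$ and $T\subseteq[n]$, $d_{\mathcal{H}}(T)=|\{H\in\mathcal{H}:T\subseteq H\}|$, and $\|\mathcal{H}\|_{t,p}=\sum_{T\in\binom{[n]}{t}}d_{\mathcal{H}}(T)^p$. The $r$-uniform linear path $P_\ell^r$ consists of $\ell$ edges ($r$-sets) $E_1,\dots,E_\ell$ such that $|E_i\cap E_{i+1}|=1$ for every $1\le i<\ell$ and $E_i\cap E_j=\emptyset$ whenever $|i-j|\ge2$. A family is $P_\ell^r$-free if it contains no $\ell$ members forming a copy of $P_\ell^r$. The family $\mathcal{H}_{n,r,a}$ is $\{H\in\binom{[n]}{r}:H\cap A\neq\emptyset\}$ for a fixed $A\subseteq[n]$ with $|A|=a$ (its isomorphism type does not depend on $A$). Two families on $[n]$ are isomorphic if a permutation of $[n]$ maps one onto the other. *)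

(* Defs.v *)
From mathcomp Require Import all_boot all_order all_fingroup all_algebra.
From mathcomp Require Import reals exp.

Set Implicit Arguments.
Unset Strict Implicit.
Unset Printing Implicit Defensive.

Import Order.TTheory GRing.Theory Num.Theory.

(* The ground set [n] = {1, ..., n} is modelled by 'I_n = {0, ..., n-1}. *)

Definition uniform (n r : nat) (H : {set {set 'I_n}}) : Prop :=
  forall E : {set 'I_n}, E \in H -> #|E| = r.

Definition degree (n : nat) (H : {set {set 'I_n}}) (T : {set 'I_n}) : nat :=
  #|[set E in H | T \subset E]|.

(* As 0 `^ p = 0 for p != 0, sets T of degree 0 contribute nothing when
   p > 0. *)
Definition tpnorm (R : realType) (n t : nat) (p : R)
    (H : {set {set 'I_n}}) : R :=
  (\sum_(T : {set 'I_n} | #|T| == t) (degree H T)%:R `^ p)%R.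

Definition linear_path (n r l : nat) (E : 'I_l -> {set 'I_n}) : Prop :=
  [/\ injective E,
      forall i : 'I_l, #|E i| = r,
      forall i j : 'I_l, j = i.+1 :> nat -> #|E i :&: E j| = 1
    & forall i j : 'I_l, i.+2 <= j -> [disjoint E i & E j]].

Definition linear_path_free (n r l : nat) (H : {set {set 'I_n}}) : Prop :=
  ~ exists E : 'I_l -> {set 'I_n},
      linear_path r E /\ forall i : 'I_l, E i \in H.

Definition meeting_family (n r : nat) (A : {set 'I_n}) : {set {set 'I_n}} :=
  [set E : {set 'I_n} | (#|E| == r) && (E :&: A != set0)].

Definition isomorphic (n : nat) (H G : {set {set 'I_n}}) : Prop :=
  exists s : {perm 'I_n}, [set s @: (E : {set 'I_n}) | E in H] = G.

(* Main.v *)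
(* An edge set containing [T] can be steered away from any bounded vertex set
   unless the degree of [T] is [O(n^(r-|T|-1))]; call [T] rich in the first
   case.  A linear path of rich sets therefore completes to a linear path of
   [H], so the graph of rich pairs, and likewise the [t]-sets of degree at least
   [n^(r-t)/K] (the heavy ones), contain no long linear path.

   Since [p > 1], only heavy [T] contribute to the main term.  Up to lower order
   they each contain exactly one vertex of the bounded set [B] of vertices of
   linear degree in the rich graph; the only exception is [(r, t) = (3, 2)],
   where they may moreover form a matching outside [B].  All but boundedly many
   vertices have at most [a] rich neighbours in [B], at most [a - 1] when they
   lie on the extra matching.  Hence the rich degrees [x_v], [v] in [B], sum to
   about at most [a n], while the contribution of [v] is of order
   [x_v^(r-1) <= x_v^2 n^(r-3)]; by convexity an [H] beating the extremal family
   has [a] vertices of almost full rich degree.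

   Finally, let [A] consist of these [a] vertices and let [L] be the union of
   the edges avoiding [A].  No vertex of [L] forms a rich pair with a vertex of
   [A], so order [|L| n^(r-2)] edges meeting [A] are missing, whereas only
   [O(|L|^(r-1))] edges lie in [L]. *)
Require Import Defs.
From mathcomp Require Import all_boot all_order all_fingroup all_algebra.
From mathcomp Require Import reals exp.
From mathcomp Require Import zify lra.

Set Implicit Arguments.
Unset Strict Implicit.
Unset Printing Implicit Defensive.

Import Order.TTheory GRing.Theory Num.Theory.

(** * Degrees and rich sets *)

(** Bounding [x^p] by [D^(p-1) * x], where [D] is the largest possible degree of a [t]-set, leaves a
    common factor [D^(p-1)]. Once it is cancelled the stability argument is linear over the natural
    numbers, with denominators multiplied out. The shape of the proof is dictated by the extra
    matching. A heavy pair in a 4-uniform or larger family extends by two vertices, so disjoint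
    heavy pairs can be chained through common linking vertices; in a 3-uniform family it extends by
    only one, and single pairs do not chain, although two heavy pairs sharing a vertex do. Hence a
    matching of linear size cannot be excluded for [(r, t) = (3, 2)] and is shown to be unprofitable
    instead: each of its vertices gives up one rich neighbour in [B], worth about [n], while its
    half of a heavy pair is worth at most about [n / 2]. This is why the set [V1] of matching
    vertices is carried through all estimates. *)

Ltac nat_lia :=
  repeat match goal with x := _ |- _ => clearbody x end;
  repeat match goal with
  | H : ?T |- _ => lazymatch T with
      | nat => fail
      | is_true (leq _ _) => fail
      | is_true (~~ odd _) => fail
      | odd _ = _ => fail
      | ~~ odd _ = _ => fail
      | is_true (odd _) => fail
      | @eq nat _ _ => fail
      | _ => clear H
      end
  end; lia.

Lemma leq_exp2rW (k m n : nat) : m <= n -> m ^ k <= n ^ k.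
Proof. by case: k => [|k] lemn //; rewrite leq_exp2r. Qed.

Lemma card_sets_between (V : finType) (X E : {set V}) (k : nat) :
  X \subset E ->
  #|X| <= k -> #|[set T : {set V} | [&& #|T| == k, X \subset T & T \subset E]]|
             = 'C(#|E| - #|X|, k - #|X|).
Proof.
move=> sXE leXk; rewrite -cardsDS // -cards_draws.
rewrite -(@card_in_imset _ _ (fun Y => X :|: Y) [set A : {set V} | A \subset E :\: X & #|A| == k - #|X|]); last first.
  move=> Y Z; rewrite !inE !subsetD => /andP[/andP[_ dY] _] /andP[/andP[_ dZ] _].
  move=> /(congr1 (fun S => S :\: X)); rewrite !setDUl setDv !set0U.
  by rewrite (setDidPl dY) (setDidPl dZ).
apply: eq_card => T; rewrite !inE; apply/and3P/imsetP.
  case=> /eqP cT sXT sTE; exists (T :\: X).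
    by rewrite !inE setSD // cardsDS // cT eqxx.
  apply/setP=> z; rewrite !inE.
  by case: (boolP (z \in X)) => // /(subsetP sXT)->.
case=> Y; rewrite !inE subsetD => /andP[/andP[sYE dY] /eqP cY] ->.
split; last 2 first.
- exact: subsetUl.
- by rewrite subUset sXE.
by rewrite cardsU (_ : X :&: Y = set0) ?cards0 ?cY ?subn0 ?subnKC //; apply/eqP; rewrite setI_eq0 disjoint_sym.
Qed.

Lemma card_sets_containing (V : finType) (X : {set V}) (k : nat) :
  #|X| <= k -> #|[set T : {set V} | (#|T| == k) && (X \subset T)]|
             = 'C(#|V| - #|X|, k - #|X|).
Proof.
move=> leXk; rewrite -cardsT -(card_sets_between (subsetT X)) //.
by apply: eq_card => T; rewrite !inE subsetT andbT.
Qed.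

Lemma degree_set0 (n : nat) (H : {set {set 'I_n}}) : degree H set0 = #|H|.
Proof. by apply: eq_card => E; rewrite !inE sub0set andbT. Qed.

Lemma degree_sum (n : nat) (H : {set {set 'I_n}}) (T : {set 'I_n}) :
  degree H T = \sum_(E in H) (T \subset E).
Proof.
rewrite /degree -sum1_card big_mkcond [RHS]big_mkcond /=.
by apply: eq_bigr => E _; rewrite !inE; case: (E \in H); case: (T \subset E).
Qed.

Lemma degree_leq_bin (n r : nat) (H : {set {set 'I_n}}) (T : {set 'I_n}) :
  uniform r H -> #|T| <= r -> degree H T <= 'C(n - #|T|, r - #|T|).
Proof.
move=> uH leTr; rewrite -[n in 'C(n - _, _)]card_ord -card_sets_containing //.
apply/subset_leq_card/subsetP=> E; rewrite !inE => /andP[/uH -> ->].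
by rewrite eqxx.
Qed.

Lemma bin_leq_exp (n k : nat) : 'C(n, k) <= n ^ k.
Proof.
apply: leq_trans (_ : n ^_ k <= _); first by rewrite -bin_ffact leq_pmulr ?fact_gt0.
by elim: k n => [|k IH] [|n] //; rewrite ffactSS expnS leq_mul2l (leq_trans (IH n)) ?orbT // leq_exp2rW.
Qed.

Lemma bin_leq_exp2 (n k : nat) : 'C(n, k) <= 2 ^ n.
Proof.
rewrite -[X in 'C(X, _)]card_ord -cardsT -cards_draws -[X in 2 ^ X]card_ord -cardsT.
rewrite -card_powerset; apply/subset_leq_card/subsetP=> X.
by rewrite !inE => /andP[].
Qed.

Lemma degree_leq_exp (n r : nat) (H : {set {set 'I_n}}) (T : {set 'I_n}) :
  uniform r H -> #|T| <= r -> degree H T <= n ^ (r - #|T|).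
Proof.
move=> uH leTr; apply: leq_trans (degree_leq_bin uH leTr) _.
by apply: leq_trans (bin_leq_exp _ _) _; rewrite leq_exp2rW ?leq_subr.
Qed.

Lemma sum_degree_containing (n r t : nat) (H : {set {set 'I_n}})
    (X : {set 'I_n}) :
  uniform r H -> #|X| <= t ->
  \sum_(T : {set 'I_n} | (#|T| == t) && (X \subset T)) degree H T
    = 'C(r - #|X|, t - #|X|) * degree H X.
Proof.
move=> uH leXt.
under eq_bigr do rewrite degree_sum.
rewrite exchange_big /= degree_sum big_distrr /=; apply: eq_bigr => E HE.
case: (boolP (X \subset E)) => sXE; last first.
  rewrite muln0 big1 // => T /andP[_ sXT].
  by case: (boolP (T \subset E)) => // /(subset_trans sXT); rewrite (negbTE sXE).
rewrite muln1 -(uH _ HE) -card_sets_between // -sum1_card.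
rewrite big_mkcond [RHS]big_mkcond /=; apply: eq_bigr => T _; rewrite !inE.
by case: (#|T| == t); case: (X \subset T); case: (T \subset E).
Qed.

Lemma sum_degree (n r t : nat) (H : {set {set 'I_n}}) :
  uniform r H ->
  \sum_(T : {set 'I_n} | #|T| == t) degree H T = 'C(r, t) * #|H|.
Proof.
move=> uH; have := @sum_degree_containing n r t H set0 uH.
rewrite cards0 !subn0 degree_set0 => <- //.
by apply: eq_bigl => T; rewrite sub0set andbT.
Qed.

Lemma sum_degree_setU1 (n r : nat) (H : {set {set 'I_n}}) (X : {set 'I_n}) :
  uniform r H ->
  \sum_(w | w \notin X) degree H (w |: X) = (r - #|X|) * degree H X.
Proof.
move=> uH; under eq_bigr do rewrite degree_sum.
rewrite exchange_big /= degree_sum big_distrr /=; apply: eq_bigr => E HE.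
case: (boolP (X \subset E)) => sXE; last first.
  rewrite muln0 big1 // => w _; rewrite subUset (negbTE sXE) andbF //.
rewrite muln1 -(uH _ HE) -cardsDS // -sum1_card.
rewrite big_mkcond [RHS]big_mkcond /=; apply: eq_bigr => w _; rewrite !inE subUset sub1set sXE andbT.
by case: (w \in X); case: (w \in E).
Qed.

(* [T] is rich when its link in [H] has no small transversal, so that [T] can
   be completed to a member of [H] avoiding any prescribed small set. *)
Definition rich (n s : nat) (H : {set {set 'I_n}}) (T : {set 'I_n}) : bool :=
  [forall W : {set 'I_n}, (#|W| <= s) && [disjoint T & W] ==>
     [exists E in H, (T \subset E) && [disjoint E & W]]].

Lemma richP (n s : nat) (H : {set {set 'I_n}}) (T : {set 'I_n}) :
  reflect (forall W : {set 'I_n}, #|W| <= s -> [disjoint T & W] ->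
             exists E, [/\ E \in H, T \subset E & [disjoint E & W]])
          (rich s H T).
Proof.
apply: (iffP forallP) => [h W cW dW | h W].
  have /implyP := h W; rewrite cW dW => /(_ isT)/existsP[E /andP[HE /andP[]]].
  by exists E.
apply/implyP=> /andP[cW dW]; have [E [HE sT dE]] := h W cW dW.
by apply/existsP; exists E; rewrite HE sT.
Qed.

Lemma rich_edge (n s : nat) (H : {set {set 'I_n}}) (E : {set 'I_n}) :
  E \in H -> rich s H E.
Proof. by move=> HE; apply/richP=> W _ dW; exists E. Qed.

(** A set witnessing non-richness meets the rest of every member through [T], so each such member is
    counted at some [w |: T]. *)
Lemma not_rich_transversal (n s : nat) (H : {set {set 'I_n}})
    (T : {set 'I_n}) :
  ~~ rich s H T ->
  exists W : {set 'I_n}, [/\ #|W| <= s, [disjoint T & W],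
    forall E, E \in H -> T \subset E -> ~~ [disjoint E & W] &
    degree H T <= \sum_(w in W) degree H (w |: T)].
Proof.
rewrite negb_forall => /existsP[W].
rewrite negb_imply negb_exists => /andP[/andP[cW dTW] /forallP hW].
have hit E : E \in H -> T \subset E -> ~~ [disjoint E & W].
  by move=> HE sTE; have := hW E; rewrite HE sTE.
exists W; split=> //; rewrite degree_sum.
under [X in _ <= X]eq_bigr do rewrite degree_sum.
rewrite exchange_big /=; apply: leq_sum => E HE.
case: (boolP (T \subset E)) => // sTE.
have /pred0Pn[w /andP[/= wE wW]] := hit E HE sTE.
by rewrite (bigD1 w) //= subUset sub1set wE sTE.
Qed.

Lemma degree_not_rich (n r s : nat) (H : {set {set 'I_n}}) (T : {set 'I_n}) :
  uniform r H -> #|T| <= r -> ~~ rich s H T ->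
  degree H T * n <= s * n ^ (r - #|T|).
Proof.
move=> uH leTr /not_rich_transversal[W [cW dTW hit le_sum]].
(* A set of full size [r] that is not rich is not a member, so its degree is 0. *)
case: (ltngtP #|T| r) leTr => // [ltTr | eqTr] _; last first.
  suff -> : degree H T = 0 by [].
  apply/eqP; rewrite /degree cards_eq0; apply/eqP/setP=> E; rewrite !inE.
  apply/negP=> /andP[HE sTE]; case/negP: (hit E HE sTE).
  suff <- : T = E by [].
  by apply/eqP; rewrite eqEcard sTE (uH _ HE) eqTr leqnn.
have -> : n ^ (r - #|T|) = n ^ (r - #|T|).-1 * n by rewrite -expnSr prednK // subn_gt0.
rewrite mulnA leq_mul2r; apply/orP; right.
apply: leq_trans le_sum _; apply: leq_trans (_ : \sum_(w in W) n ^ (r - #|T|).-1 <= _).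
  apply: leq_sum => w wW; have wT : w \notin T.
    by apply/negP=> wT; move/disjointFr: dTW => /(_ w wT); rewrite wW.
  apply: leq_trans (degree_leq_exp uH _) _; rewrite cardsU1 wT //.
  by rewrite add1n subnS.
by rewrite sum_nat_const leq_mul2r cW orbT.
Qed.

(** * Linear paths *)

(** Unlike in [linear_path], no sizes are prescribed, so pairs, triples and whole edges can be mixed
    in one path; only the values below [l] matter. *)
Definition skeleton (n l : nat) (S : nat -> {set 'I_n}) : Prop :=
  (forall i, i.+1 < l -> #|S i :&: S i.+1| = 1) /\
  (forall i j, i.+1 < j -> j < l -> [disjoint S i & S j]).

Definition has_path (n l : nat) (F : {set {set 'I_n}}) : Prop :=
  exists2 S : nat -> {set 'I_n}, skeleton l S & forall i, i < l -> S i \in F.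

Lemma linear_path_free_has_path (n r l : nat) (H : {set {set 'I_n}}) :
  1 < r -> uniform r H -> linear_path_free r l H -> ~ has_path l H.
Proof.
move=> r1 uH fH [S [S1 S2] SH]; apply: fH.
have cS i : i < l -> #|S i| = r by move=> /SH /uH.
(* A repeated set would meet itself in no vertex or in one, against [1 < r]. *)
have neq i j : i < j -> j < l -> S i <> S j.
  move=> ij jl eS; have := cS j jl; case: (ltngtP i.+1 j) (ij) => // [ij' | eij] _.
    have := S2 i j ij' jl; rewrite eS -setI_eq0 setIid => /eqP->.
    by rewrite cards0 => r0; rewrite -r0 in r1.
  have := S1 i; rewrite eij -eS setIid eS => /(_ jl)-> r_1.
  by rewrite -r_1 in r1.
exists (fun i : 'I_l => S i); split; last by move=> i; exact: SH.
split.
- move=> i j eS; apply/val_inj/eqP; apply/negPn/negP; rewrite neq_ltn.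
  by case/orP=> [ij | ji]; [apply: (neq i j) | apply: (neq j i)].
- by move=> i; exact: cS.
- by move=> i j e; rewrite e S1 // -e.
- by move=> i j ij; exact: S2.
Qed.

Lemma card_bigcup_leq (V : finType) (m c : nat) (S : nat -> {set V}) :
  (forall i, i < m -> #|S i| <= c) -> #|\bigcup_(i < m) S i| <= c * m.
Proof.
elim: m => [|m IH] hS; first by rewrite big_ord0 cards0.
rewrite big_ord_recr /= mulnSr.
apply: leq_trans (_ : #|\bigcup_(i < m) S i| + #|S m| <= _); last first.
  by rewrite leq_add ?hS ?IH // => i im; rewrite hS // ltnW.
by rewrite -cardsUI leq_addr.
Qed.

(* A skeleton of rich sets is completed one set at a time: each rich set grows
   to a member of [H] avoiding everything else placed so far. *)
Lemma rich_skeleton (n r s l : nat) (H : {set {set 'I_n}})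
    (S : nat -> {set 'I_n}) :
  uniform r H -> r * l <= s -> skeleton l S ->
  (forall i, i < l -> #|S i| <= r) -> (forall i, i < l -> rich s H (S i)) ->
  has_path l H.
Proof.
move=> uH rls skS cS rS.
suff grow m : m <= l -> exists2 S', skeleton l S' &
    (forall i, i < l -> #|S' i| <= r) /\
    (forall i, i < l -> rich s H (S' i) /\ (i < m -> S' i \in H)).
  have [S' sk [_ HS']] := grow l (leqnn l); exists S' => // i il.
  by have [_ ->] := HS' i il.
elim: m => [_ | m IH ml]; first by exists S => //; split=> // i il; split; first exact: rS.
have [S' [sk1 sk2] [cS' hS']] := IH (ltnW ml).
pose W := (\bigcup_(i < l) S' i) :\: S' m.
have [||E [HE sE dE]] := (richP _ _ _ (proj1 (hS' m ml))) W.
- apply: leq_trans rls; apply: leq_trans (card_bigcup_leq cS').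
  exact/subset_leq_card/subsetDl.
- by rewrite disjoints_subset; apply/subsetP=> x; rewrite !inE => ->.
(* [E] grows [S' m] only by vertices outside all the other sets, so the replacement changes no
   intersection. *)
have capE j : j < l -> j != m -> E :&: S' j = S' m :&: S' j.
  move=> jl _; apply/setP=> x; rewrite !inE.
  case: (boolP (x \in S' m)) => [/(subsetP sE)-> // | xm] /=.
  case: (boolP (x \in E)) => //= xE; apply/negP=> xj.
  move/disjointFr: dE => /(_ x xE); rewrite !inE xm => /negP; apply.
  by apply/bigcupP; exists (Ordinal jl).
exists (fun i => if i == m then E else S' i); first split.
- move=> i il; case: eqP => [ei | /eqP ni]; case: eqP => [ei' | /eqP ni'].
  + by have := ltnn i; rewrite {2}ei -ei' ltnSn.
  + by rewrite capE // -ei sk1.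
  + by rewrite setIC capE ?(ltnW il) // setIC -ei' sk1.
  + exact: sk1.
- move=> i j ij jl; have il : i < l by lia.
  have := sk2 i j ij jl; rewrite -!setI_eq0.
  case: (i =P m) => [ei | /eqP ni]; case: (j =P m) => [ej | /eqP nj] //.
  + by lia.
  + by rewrite capE // -ei.
  + by rewrite (setIC _ E) capE // (setIC (S' m)) -ej.
split=> i il; case: eqP => [_ | /eqP ni].
- by rewrite (uH _ HE).
- exact: cS'.
- by split=> //; exact: rich_edge.
have [ri Hi] := hS' i il; split=> // im; apply: Hi.
by rewrite ltn_neqAle ni -ltnS.
Qed.

(** The last member meets the earlier ones in at most one vertex, so it has a free vertex [y];
    richness of [[set y]] supplies a next member touching the path only in [y]. *)
Lemma greedy_path (n k s l : nat) (F : {set {set 'I_n}}) :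
  uniform k F -> 1 < k -> F != set0 -> k * l <= s ->
  (forall E y, E \in F -> y \in E -> rich s F [set y]) -> has_path l F.
Proof.
move=> uF k1 /set0Pn[E0 FE0] kls hr.
suff grow m : m < l -> exists2 S, skeleton m.+1 S & forall i, i <= m -> S i \in F.
  case: l kls grow => [|l] _ grow; last first.
    by have [S skS SF] := grow l (ltnSn l); exists S.
  by exists (fun=> E0) => //; split.
elim: m => [_ | m IH ml]; first by exists (fun=> E0) => //; split=> // i [].
have [S [sk1 sk2] SF] := IH (ltnW ml).
pose P := \bigcup_(i < m) S i.
have [y ySm yP] : exists2 y, y \in S m & y \notin P.
  have lt1 : #|S m :&: P| <= 1.
    case: m ml IH sk1 sk2 SF @P => [|m] ml IH sk1 sk2 SF P.
      by rewrite /P big_ord0 setI0 cards0.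
    rewrite -(sk1 m) //; apply/subset_leq_card/subsetP=> x.
    rewrite !inE => /andP[xS /bigcupP[[i im] _ /= xi]]; rewrite xS andbT.
    move: im; rewrite ltnS leq_eqVlt => /orP[/eqP <- // | im].
    have := sk2 i m.+1 im (ltnSn _); rewrite -setI_eq0 => /eqP/setP/(_ x).
    by rewrite !inE xi xS.
  have : 0 < #|S m :\: P|.
    by rewrite cardsD (uF _ (SF m _)) // subn_gt0 (leq_ltn_trans lt1).
  by case/card_gt0P=> y; rewrite inE => /andP[]; exists y.
pose W := (\bigcup_(i < m.+1) S i) :\ y.
have [||E [FE yE dE]] := (richP _ _ _ (hr (S m) y (SF m (leqnn m)) ySm)) W.
- apply: leq_trans kls; apply: leq_trans (_ : k * m.+1 <= _); last by rewrite leq_mul2l ltnW ?orbT.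
  apply: leq_trans (subset_leq_card (subD1set _ _)) _.
  by apply: card_bigcup_leq => i im; rewrite (uF _ (SF i _)).
- by rewrite disjoints_subset sub1set !inE eqxx.
rewrite sub1set in yE.
have capE i x : i <= m -> x \in S i -> x \in E -> x = y.
  move=> im xi xE; apply/eqP/negPn/negP=> xy.
  move/disjointFr: dE => /(_ x xE)/negP; apply; rewrite !inE xy.
  by apply/bigcupP; exists (Ordinal (im : i < m.+1)).
exists (fun i => if i <= m then S i else E); last first.
  by move=> i; case: (leqP i m) => // im _; exact: SF.
split.
- move=> i; rewrite ltnS => im; rewrite -ltnS im.
  case: (ltnP i m) => [im' | mi]; first by rewrite sk1.
  have -> : i = m by lia.
  apply/eqP/cards1P; exists y; apply/setP=> x; rewrite !inE.
  apply/andP/eqP => [[]| ->]; first exact: capE.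
  by split.
- move=> i j ij jm; have im : i <= m by lia.
  rewrite im; case: (leqP j m) => [jm' | mj]; first exact: sk2.
  rewrite -setI_eq0; apply/eqP/setP=> x; rewrite !inE; apply/negP=> /andP[xi xE].
  have xy := capE i x im xi xE; case/negP: yP; apply/bigcupP.
  have im' : i < m by lia.
  by exists (Ordinal im'); rewrite // -xy.
Qed.

(* Deleting, as long as possible, all members through a [j]-set of degree at
   most [c] removes at most [c] members per deleted [j]-set. *)
Lemma dense_subfamily (n j c : nat) (F : {set {set 'I_n}}) :
  c * #|[set X : {set 'I_n} | (#|X| == j) && [exists E in F, X \subset E]]|
    < #|F| ->
  exists F' : {set {set 'I_n}}, [/\ F' \subset F, F' != set0 &
    forall E X : {set 'I_n}, E \in F' -> X \subset E -> #|X| = j -> c < degree F' X].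
Proof.
elim: {F}_.+1 {-2}F (ltnSn #|F|) => // m IH F; rewrite ltnS => Fm cF.
case: (boolP [exists X : {set 'I_n}, [&& #|X| == j, degree F X <= c & [exists E in F, X \subset E]]]); last first.
  move/existsPn=> h; exists F; split=> //.
    by rewrite -card_gt0; apply: leq_trans cF.
  move=> E X FE sX cX; rewrite ltnNge; have := h X; rewrite cX eqxx /=.
  rewrite negb_and => /orP[// | /negP[]]; apply/existsP; exists E.
  by rewrite FE.
case/existsP=> X /and3P[cX dX /existsP[E /andP[FE sXE]]].
pose F1 := [set E in F | ~~ (X \subset E)].
have cF1 : #|F| = #|F1| + degree F X.
  rewrite -(cardsID [set E : {set 'I_n} | X \subset E] F) addnC /degree; congr (_ + _).
    by apply: eq_card => D; rewrite !inE andbC.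
  by apply: eq_card => D; rewrite !inE.
have dX0 : 0 < degree F X by apply/card_gt0P; exists E; rewrite inE FE.
have [|| F' [sF' nF' hF']] := IH F1.
- by lia.
- have : #|[set Y : {set 'I_n} | (#|Y| == j) && [exists E in F1, Y \subset E]]|.+1
         <= #|[set Y : {set 'I_n} | (#|Y| == j) && [exists E in F, Y \subset E]]|.
    apply: proper_card; apply/properP; split.
      apply/subsetP=> Y; rewrite !inE => /andP[-> /existsP[D /andP[]]].
      by rewrite inE => /andP[FD _] sYD; apply/existsP; exists D; rewrite FD.
    exists X; rewrite !inE ?cX; first by apply/existsP; exists E; rewrite FE.
    by apply/negP=> /existsP[D]; rewrite inE => /andP[/andP[_ /negP]].
  move=> lt; have := leq_mul2l c _.+1 #|[set Y : {set 'I_n} | (#|Y| == j) && [exists E in F, Y \subset E]]|.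
  move/(_ #|[set Y : {set 'I_n} | (#|Y| == j) && [exists E in F1, Y \subset E]]|).
  rewrite lt orbT => le; lia.
exists F'; split=> //; apply: subset_trans sF' _.
by apply/subsetP=> D; rewrite inE => /andP[].
Qed.

(** Exchange argument: take a member through [y] meeting [W] least. A vertex of it in [W] could be
    swapped for one outside, as the other [k - 1] vertices have more than [#|W|] extensions. *)
Lemma dense_rich (n k c s : nat) (F : {set {set 'I_n}}) :
  uniform k F -> s <= c ->
  (forall E X : {set 'I_n}, E \in F -> X \subset E -> #|X| = k.-1 ->
     c < degree F X) ->
  forall E y, E \in F -> y \in E -> rich s F [set y].
Proof.
move=> uF sc hF E y FE yE; apply/richP=> W cW; rewrite disjoint_sym disjoints_subset => /subsetP yW.
pose P (D : {set 'I_n}) := (D \in F) && (y \in D).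
have PE : P E by rewrite /P FE.
case: (arg_minnP (fun D : {set 'I_n} => #|D :&: W|) PE) => D /andP[FD yD] minD.
exists D; rewrite sub1set; split=> //; rewrite -setI_eq0; apply/eqP/eqP.
apply/negPn/negP=> /set0Pn[z]; rewrite inE => /andP[zD zW].
have zy : z != y by have := yW z zW; rewrite !inE.
have cDz : #|D :\ z| = k.-1 by rewrite -(uF _ FD) (cardsD1 z D) zD.
have := hF D _ FD (subD1set D z) cDz.
apply/negP; rewrite -leqNgt; apply: leq_trans sc; apply: leq_trans cW.
apply: leq_trans (leq_imset_card (fun w => w |: (D :\ z)) W).
apply/subset_leq_card/subsetP=> D'; rewrite inE => /andP[FD' sD'].
have yD' : y \in D' by apply: (subsetP sD'); rewrite !inE yD eq_sym zy.
have PD' : P D' by rewrite /P FD' yD'.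
have k0 : 0 < k by rewrite -(uF _ FD); apply/card_gt0P; exists z.
have eq1 : #|D' :\: (D :\ z)| == 1.
  by rewrite cardsDS // (uF _ FD') cDz -subn1 subKn.
case/cards1P: eq1 => w ew.
have eD' : D' = w |: (D :\ z).
  by rewrite -ew setUC -[LHS](setID _ (D :\ z)) (setIidPr sD').
apply/imsetP; exists w => //; apply/negPn/negP=> wW.
have := minD D' PD'; apply/negP; rewrite -ltnNge; apply: proper_card.
apply/properP; split; last first.
  exists z; rewrite !inE ?zD ?zW // eD' !inE eqxx /= orbF.
  by apply/negP=> /andP[/eqP zw _]; rewrite -zw zW in wW.
rewrite eD'; apply/subsetP=> x; rewrite !inE => /andP[/orP[/eqP-> | /andP[_ ->]] //].
by rewrite (negbTE wW).
Qed.

(** A larger family keeps, after deletions, a subfamily in which the greedy path fits. Bounding by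
    [#|U|] rather than [n] is what later makes the edges avoiding [A] negligible. *)
Lemma card_no_path (n k l : nat) (F : {set {set 'I_n}}) (U : {set 'I_n}) :
  uniform k F -> 1 < k -> (forall E, E \in F -> E \subset U) ->
  ~ has_path l F -> #|F| <= k * l * #|U| ^ k.-1.
Proof.
move=> uF k1 sU np; rewrite leqNgt; apply/negP=> ltF; apply: np.
have [|F' [sF' nF' hF']] := @dense_subfamily n k.-1 (k * l) F.
  apply: leq_ltn_trans ltF; rewrite leq_mul2l; apply/orP; right.
  apply: leq_trans (bin_leq_exp _ _); rewrite -cards_draws.
  apply/subset_leq_card/subsetP=> X; rewrite !inE => /andP[-> /existsP[E /andP[FE sXE]]].
  by rewrite (subset_trans sXE) ?sU.
have uF' : uniform k F' by move=> E /(subsetP sF')/uF.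
have [S skS SF] := greedy_path uF' k1 nF' (leqnn _) (dense_rich uF' (leqnn _) hF').
by exists S => // i il; apply: (subsetP sF'); exact: SF.
Qed.

Lemma rich_family_no_path (n r k s l : nat) (H F : {set {set 'I_n}}) :
  uniform r H -> uniform k F -> k <= r -> r * l <= s ->
  (forall T, T \in F -> rich s H T) -> ~ has_path l H -> ~ has_path l F.
Proof.
move=> uH uF kr rls hF np [S skS SF]; apply: np.
apply: (rich_skeleton uH rls skS) => i il; last exact: hF (SF i il).
by rewrite (uF _ (SF i il)).
Qed.

(** A minimal vertex set of large average degree has minimum degree above [l], and there a path
    grows greedily. *)
Lemma graph_path (n l : nat) (e : rel 'I_n) :
  symmetric e -> 2 * l * n < \sum_x #|[set y | e x y]| ->
  exists p : seq 'I_n, [/\ size p = l.+1, uniq p & sorted e p].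
Proof.
move=> se ltn.
pose d (U : {set 'I_n}) x := #|[set y in U | e x y]|.
pose P (U : {set 'I_n}) := 2 * l * #|U| < \sum_(x in U) d U x.
have PT : exists U, P U.
  exists setT; rewrite /P cardsT card_ord; apply: leq_trans ltn _.
  rewrite [X in _ <= X](eq_bigl xpredT) => [|x]; last by rewrite inE.
  by apply: leq_sum => x _; apply/subset_leq_card/subsetP=> y; rewrite !inE.
have [U /minsetP[PU minU]] := ex_minset PT.
have dU x : x \in U -> l < d U x.
  move=> xU; rewrite ltnNge; apply/negP=> dx.
  suff /minU : P (U :\ x) => [/(_ (subD1set _ _))/setP/(_ x)|].
    by rewrite !inE eqxx xU.
  (* The factor 2: [x] counts in its own degree and in those of its neighbours. *)
  have le_sum : \sum_(y in U) d U y <= \sum_(y in U :\ x) d (U :\ x) y + 2 * d U x.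
    rewrite (big_setD1 x xU) /= addnC mul2n -addnn addnA leq_add2r.
    apply: leq_trans (_ : \sum_(y in U :\ x) (d (U :\ x) y + e x y) <= _).
      apply: leq_sum => y yU; rewrite /d (cardsD1 x) addnC leq_add //.
        apply/subset_leq_card/subsetP=> z; rewrite !inE.
        by case/and3P=> -> -> ->.
      by rewrite inE xU /= se; case: (e x y).
    rewrite big_split leq_add2l /= /d -sum1_card big_mkcond [X in _ <= X]big_mkcond.
    apply: leq_sum => y _; rewrite !inE.
    by case: (y == x); case: (y \in U); case: (e x y).
  move: PU; rewrite /P (cardsD1 x U) xU; lia.
have [x0 x0U] : exists x0, x0 \in U.
  case: (set_0Vmem U) PU => [-> | [x xU] _]; last by exists x.
  by rewrite /P big_set0 ltn0.
suff grow m : m <= l -> exists p : seq 'I_n,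
    [/\ size p = m.+1, uniq p, sorted e p & {subset p <= U}].
  by have [p [? ? ? _]] := grow l (leqnn l); exists p.
elim: m => [_ | m IH ml].
  by exists [:: x0]; split=> // x; rewrite inE => /eqP->.
have [p0 [sp up ep pU]] := IH (ltnW ml).
case: p0 sp up ep pU => [|x p] // [sp] up ep pU.
have xU : x \in U by rewrite pU ?mem_head.
have [y] : exists y, y \in [set y in U | e x y] :\: [set z in x :: p].
  apply/set0Pn; rewrite -card_gt0 cardsD subn_gt0.
  apply: leq_ltn_trans (_ : m.+1 < _); last by apply: leq_trans (dU x xU); lia.
  apply: leq_trans (subset_leq_card (subsetIr _ _)) _.
  by rewrite cardsE; apply: leq_trans (card_size _) _; rewrite /= sp.
rewrite !inE => /andP[yp /andP[yU exy]].
exists (y :: x :: p); split=> //=.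
- by rewrite sp.
- by move: up; rewrite /= inE yp.
- by rewrite se exy.
- by move=> z; rewrite inE => /orP[/eqP-> // | /pU].
Qed.

(** * The graph of rich pairs *)

Definition nbr (n s : nat) (H : {set {set 'I_n}}) (v : 'I_n) : {set 'I_n} :=
  [set w | (w != v) && rich s H [set v; w]].

Lemma nbr_sym (n s : nat) (H : {set {set 'I_n}}) (v w : 'I_n) :
  (w \in nbr s H v) = (v \in nbr s H w).
Proof. by rewrite !inE eq_sym setUC. Qed.

(** The path is [S0] followed by the pairs of consecutive vertices. Leaving the shape of [S0] open
    allows a whole edge avoiding [A] to come first. *)
Lemma rich_walk (n r s m : nat) (H : {set {set 'I_n}}) (S0 : {set 'I_n})
    (y : nat -> 'I_n) :
  uniform r H -> 1 < r -> r * m.+1 <= s -> rich s H S0 -> #|S0| <= r ->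
  y 0 \in S0 -> (forall i, i < m -> y i.+1 \notin S0) ->
  (forall i j, i < j -> j <= m -> y i != y j) ->
  (forall i, i < m -> y i.+1 \in nbr s H (y i)) ->
  has_path m.+1 H.
Proof.
move=> uH r1 rms rS0 cS0 y0 yS0 yinj yr.
pose S i := if i is j.+1 then [set y j; y j.+1] else S0.
have yneq i j : i <= m -> j <= m -> i != j -> y i != y j.
  move=> im jm; rewrite neq_ltn => /orP[ij | ji]; first exact: yinj.
  by rewrite eq_sym; apply: yinj.
apply: (rich_skeleton (S := S) uH rms); first split.
- case=> [|i]; rewrite ltnS => im; apply/eqP/cards1P.
    exists (y 0); apply/setP=> z; rewrite !inE.
    apply/andP/eqP=> [[zS0 /orP[/eqP // | /eqP zy]] | ->]; last by rewrite y0 eqxx.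
    by have := yS0 0 im; rewrite -zy zS0.
  exists (y i.+1); apply/setP=> z; rewrite !inE.
  apply/andP/eqP=> [[/orP[]/eqP-> /orP[]/eqP] | ->] //; last by rewrite eqxx orbT.
  by move/eqP; rewrite (negbTE (yneq i i.+2 _ _ _)) //; nat_lia.
- case=> [|i] [|j] //; rewrite ltnS => ij jm; rewrite -setI_eq0; apply/eqP/setP=> z; rewrite !inE; apply/negP.
    case/andP=> zS0 /orP[]/eqP zy.
      have := yS0 j.-1; rewrite prednK // -zy zS0 => h.
      suff : ~~ true by [].
      by apply: h; nat_lia.
    by have := yS0 j jm; rewrite -zy zS0.
  case/andP=> /orP[]/eqP-> /orP[]; apply/negP; apply: yneq; nat_lia.
- move=> [|i] // im; apply: leq_trans (_ : 2 <= _) => //.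
  by rewrite cards2; case: (_ == _).
- by move=> [|i] // im; have := yr i im; rewrite inE => /andP[].
Qed.

Lemma sum_nbr_leq (n r s l : nat) (H : {set {set 'I_n}}) :
  uniform r H -> 1 < r -> 0 < l -> r * l <= s -> ~ has_path l H ->
  \sum_v #|nbr s H v| <= 2 * l * n.
Proof.
move=> uH r1 l0 rls np; rewrite leqNgt; apply/negP=> lt; apply: np.
have [||p [sp up ep]] := @graph_path n l (fun v w => w \in nbr s H v).
- by move=> v w; rewrite nbr_sym.
- by apply: leq_trans lt _; apply: leq_sum => v _; rewrite (eq_card (B := nbr s H v)) // => w; rewrite inE.
case: p sp up ep => [|v0 p] // [sp] up ep; case: l l0 rls lt sp => // l _ rls lt sp.
have yn i j : i < j -> j <= l.+1 -> nth v0 (v0 :: p) i != nth v0 (v0 :: p) j.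
  by move=> ij jl; rewrite nth_uniq //= ?sp; lia.
have ye i : i <= l -> nth v0 (v0 :: p) i.+1 \in nbr s H (nth v0 (v0 :: p) i).
  by move=> il; apply: (pathP v0 ep); rewrite sp.
apply: (@rich_walk n r s l H [set v0; nth v0 p 0] (fun i => nth v0 p i)) => //.
- by have := ye 0 isT; rewrite inE => /andP[].
- by rewrite cards2; case: (_ == _); lia.
- by rewrite !inE eqxx orbT.
- move=> i il; rewrite !inE negb_or eq_sym (yn 0 i.+2) // eq_sym (yn 1 i.+2) //; lia.
- by move=> i j ij jl; exact: (yn i.+1 j.+1).
- by move=> i il; exact: (ye i.+1).
Qed.

Lemma card_big_leq (n q c : nat) (f : 'I_n -> nat) :
  0 < n -> \sum_v f v <= c * n -> #|[set v | n <= q * f v]| <= q * c.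
Proof.
move=> n0 hf; rewrite -(leq_pmul2r n0) -mulnA; apply: leq_trans (leq_mul (leqnn q) hf).
rewrite -sum_nat_const big_distrr /= big_mkcond /=.
by apply: leq_sum => v _; rewrite inE; case: ifP.
Qed.

(* The walk alternates between the vertices of [A] and their common
   neighbours, so it uses two edges per vertex of [A]. *)
Lemma rich_alternating_walk (n r s a : nat) (H : {set {set 'I_n}})
    (S0 A : {set 'I_n}) (x v1 : 'I_n) :
  uniform r H -> 1 < r -> r * (2 * a + 1) <= s -> rich s H S0 -> #|S0| <= r ->
  #|A| = a -> [disjoint S0 & A] -> x \in S0 -> v1 \in A -> x \in nbr s H v1 ->
  r + a <= #|[set z | [forall v in A, z \in nbr s H v]]| ->
  has_path (2 * a + 1) H.
Proof.
move=> uH r1 rs rS0 cS0 cA dA xS0 v1A xv1 cZ.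
set Z := [set z | _] in cZ.
have hZ z v : z \in Z -> v \in A -> z \in nbr s H v.
  by rewrite inE => /forall_inP h /h.
(* [x] is only known to be adjacent to [v1]; the later vertices of [zs] are common neighbours of
   [A], and at least [a] of the [r + a] remain after discarding [S0]. *)
pose vs := v1 :: enum (A :\ v1); pose zs := x :: enum (Z :\: S0).
have svs : size vs = a by rewrite /= -cardE -cA (cardsD1 v1 A) v1A.
have szs : a < size zs.
  rewrite /= ltnS -cardE cardsD leq_subRL; last exact: subset_leq_card (subsetIl _ _).
  by apply: leq_trans cZ; rewrite leq_add2r; apply: leq_trans cS0; apply/subset_leq_card/subsetIr.
have uvs : uniq vs by rewrite /= enum_uniq mem_enum !inE eqxx.
have uzs : uniq zs by rewrite /= enum_uniq mem_enum !inE xS0.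
have vsA i : i < a -> nth x vs i \in A.
  rewrite -svs => /(mem_nth x); rewrite inE => /orP[/eqP-> // |].
  by rewrite mem_enum !inE => /andP[].
have zsZ i : 0 < i <= a -> nth x zs i \in Z :\: S0.
  case: i => // i; rewrite ltnS => ia; rewrite -mem_enum; apply: mem_nth.
  by move: szs; rewrite /= ltnS; apply: leq_trans.
have nZA z : z \in Z -> z \notin A.
  by move=> zZ; apply/negP=> /(hZ z z zZ); rewrite !inE eqxx.
have zsA i : i <= a -> nth x zs i \notin A.
  case: (posnP i) => [-> _ | i0 ia].
    by apply/negP=> xA; move/disjointFr: dA => /(_ x xS0); rewrite xA.
  by apply: nZA; have := zsZ i; rewrite i0 ia inE => /(_ isT)/andP[].
have adj i j : i <= a -> j < a -> (i = 0 -> j = 0) -> nth x zs i \in nbr s H (nth x vs j).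
  case: (posnP i) => [-> _ _ -> // | i0 ia ja _].
  by apply: hZ; [have := zsZ i; rewrite i0 ia inE => /(_ isT)/andP[] | exact: vsA].
pose y i := if odd i then nth x vs i./2 else nth x zs i./2.
rewrite addn1; apply: (@rich_walk n r s (2 * a) H S0 y) => //.
- by rewrite -addn1.
- move=> i ia; rewrite /y; case: ifP => oi.
    apply/negP=> yS0; move/disjointFr: dA => /(_ _ yS0); rewrite vsA //; nat_lia.
  have := zsZ i.+1./2; rewrite !inE => h; have /h/andP[] // : 0 < i.+1./2 <= a by nat_lia.
- move=> i j ij ja; rewrite /y; case: ifP => oi; case: ifP => oj.
  + by rewrite nth_uniq ?svs //; nat_lia.
  + have := zsA j./2; have := vsA i./2; move=> h1 h2; apply: contraTneq (h1 _) => [e|]; last by nat_lia.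
    by rewrite e h2 //; nat_lia.
  + have := zsA i./2; have := vsA j./2; move=> h1 h2; apply: contraTneq (h1 _) => [e|]; last by nat_lia.
    by rewrite -e h2 //; nat_lia.
  + by rewrite nth_uniq //; first nat_lia; apply: leq_ltn_trans szs; nat_lia.
- move=> i ia; rewrite /y /=; case: ifP => oi; case: ifP => oi'; try by nat_lia.
    have -> : uphalf i = i./2 by nat_lia.
    by rewrite nbr_sym; apply: adj; nat_lia.
  by apply: adj; nat_lia.
Qed.

Lemma exists_subset_card (V : finType) (X : {set V}) (a : nat) :
  a <= #|X| -> exists2 A : {set V}, A \subset X & #|A| = a.
Proof.
move=> leaX; have : 0 < 'C(#|X|, a) by rewrite bin_gt0.
rewrite -cards_draws => /card_gt0P[A]; rewrite inE => /andP[sAX /eqP cA].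
by exists A.
Qed.

(** Pigeonhole on the traces in [B]: too many such vertices would include more than [r + a] with [a]
    common neighbours in [B]. One of them together with a further rich neighbour is the first set of
    an alternating walk. *)
Lemma card_crowded_leq (n r s a : nat) (H : {set {set 'I_n}}) (B : {set 'I_n}) :
  uniform r H -> 1 < r -> 0 < a -> r * (2 * a + 1) <= s ->
  ~ has_path (2 * a + 1) H ->
  #|[set w | [&& w \notin B, a <= #|nbr s H w :&: B| & a < #|nbr s H w|]]|
    <= (r + a) * 2 ^ #|B|.
Proof.
move=> uH r1 a0 rs np; set Z := [set w | _]; rewrite leqNgt; apply/negP=> ltZ; apply: np.
pose fib X := [set w in Z | nbr s H w :&: B == X].
have sumZ : #|Z| = \sum_(X in powerset B) #|fib X|.
  rewrite -sum1_card (partition_big (fun w => nbr s H w :&: B) (fun X => X \in powerset B)) /=; last first.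
    by move=> w _; rewrite powersetE subsetIr.
  by apply: eq_bigr => X _; rewrite sum1dep_card; apply: eq_card => w; rewrite !inE.
have [X sXB ltX] : exists2 X, X \in powerset B & r + a < #|fib X|.
  apply/exists_inP; apply: contraTT ltZ => /exists_inPn h.
  rewrite -leqNgt sumZ mulnC -card_powerset -sum_nat_const; apply: leq_sum => X XB.
  by rewrite leqNgt; exact: h.
have [w1] : exists w1, w1 \in fib X by apply/set0Pn; rewrite -card_gt0; lia.
rewrite !inE => /andP[/and3P[w1B aX aw1] /eqP eX].
rewrite eX in aX; have [A sAX cA] := exists_subset_card aX.
have [w2] : exists w2, w2 \in nbr s H w1 :\: A.
  apply/set0Pn; rewrite -card_gt0 cardsD subn_gt0.
  by apply: leq_ltn_trans (subset_leq_card (subsetIr _ _)) _; rewrite cA.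
rewrite inE => /andP[w2A w2w1].
have [v1 v1A] : exists v1, v1 \in A by apply/set0Pn; rewrite -card_gt0 cA.
have hA w v : w \in fib X -> v \in A -> w \in nbr s H v.
  rewrite inE => /andP[_ /eqP eXw] /(subsetP sAX).
  by rewrite -eXw inE nbr_sym => /andP[].
have w1X : w1 \in fib X by rewrite !inE w1B eX aX aw1 eqxx.
apply: (@rich_alternating_walk n r s a H [set w1; w2] A w1 v1) => //.
- by move: w2w1; rewrite inE => /andP[].
- by rewrite cards2; case: (_ != _); rewrite ?(ltnW r1).
- rewrite -setI_eq0; apply/eqP/setP=> z; rewrite !inE; apply/negP=> /andP[/orP[]/eqP->].
    move/(subsetP sAX); rewrite powersetE in sXB => /(subsetP sXB).
    by apply/negP.
  by apply/negP.
- by rewrite !inE eqxx.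
- exact: hA.
apply: leq_trans (ltnW ltX) _; apply/subset_leq_card/subsetP=> z zX.
by rewrite inE; apply/forall_inP=> v vA; exact: hA.
Qed.

(** Counted from outside [B]: a vertex that is not crowded has at most [a] rich neighbours in [B],
    and at most [a - 1] if it lies in [V1], since it then has one more off [B]. The error terms come
    from the crowded vertices and the pairs inside [B]. *)
Lemma sum_nbr_big_leq (n r s a : nat) (H : {set {set 'I_n}}) (B V1 : {set 'I_n}) :
  uniform r H -> 1 < r -> 0 < a -> r * (2 * a + 1) <= s ->
  ~ has_path (2 * a + 1) H ->
  (forall w, w \in V1 -> w \notin B /\ exists2 z, z \in nbr s H w & z \notin B) ->
  \sum_(v in B) #|nbr s H v| + #|V1|
    <= a * n + (#|B|.+1 * ((r + a) * 2 ^ #|B|) + #|B| * #|B|).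
Proof.
move=> uH r1 a0 rs np hV1.
have := card_crowded_leq B uH r1 a0 rs np; set Z := [set w | _] => cZ.
have eq_deg v : #|nbr s H v| = \sum_w (w \in nbr s H v).
  by rewrite -sum1_card big_mkcond; apply: eq_bigr => w _; case: ifP.
have split_sum : \sum_(v in B) #|nbr s H v| <=
    #|B| * #|B| + \sum_(w | w \notin B) #|nbr s H w :&: B|.
  under eq_bigr do rewrite eq_deg.
  rewrite exchange_big /= (bigID (fun w => w \in B)) /= leq_add //.
    rewrite -sum_nat_const; apply: leq_sum => w _.
    by rewrite -sum1_card; apply: leq_sum => v _; case: (w \in _).
  apply: leq_sum => w _; rewrite -sum1_card big_mkcond [X in _ <= X]big_mkcond /=.
  apply: leq_sum => v _; rewrite in_setI nbr_sym.
  by case: (v \in B); case: (v \in nbr s H w).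
have sV1 : #|V1| = \sum_(w | w \notin B) (w \in V1).
  rewrite -sum1_card big_mkcond [RHS]big_mkcond /=; apply: eq_bigr => w _.
  by case: ifP => [/hV1[-> _] | _] //; case: ifP.
have key : \sum_(w | w \notin B) (#|nbr s H w :&: B| + (w \in V1))
   <= \sum_(w | w \notin B) (a + #|B|.+1 * (w \in Z)).
  apply: leq_sum => w wB; case: (boolP (w \in Z)) => wZ.
    rewrite /= muln1 -addn1; apply: leq_trans (leq_addl a _).
    by rewrite leq_add ?leq_b1 //; apply/subset_leq_card/subsetIr.
  rewrite muln0 addn0; move: wZ; rewrite inE wB /= negb_and -ltnNge -leqNgt.
  case: (boolP (w \in V1)) => [/hV1[_ [z zw zB]] | _] /= => [|h]; last first.
    rewrite addn0; case/orP: h => [/ltnW // | ]; apply: leq_trans.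
    exact/subset_leq_card/subsetIl.
  have : #|nbr s H w :&: B| < #|nbr s H w|.
    apply: proper_card; apply/properP; split; first exact: subsetIl.
    by exists z => //; rewrite inE (negbTE zB) andbF.
  by rewrite addn1 => lt /orP[// |]; exact: leq_trans.
have le_an : \sum_(w | w \notin B) (a + #|B|.+1 * (w \in Z)) <= a * n + #|B|.+1 * #|Z|.
  rewrite big_split /= leq_add //.
    by rewrite sum_nat_const mulnC leq_mul2l (leq_trans (max_card _)) ?card_ord ?orbT.
  rewrite -big_distrr leq_mul // -sum1_card big_mkcond [X in _ <= X]big_mkcond /=.
  by apply: leq_sum => w _; case: (w \in B); case: (w \in Z).
rewrite big_split /= -sV1 in key.
have le3 : #|B|.+1 * #|Z| <= #|B|.+1 * ((r + a) * 2 ^ #|B|) by rewrite leq_mul2l cZ orbT.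
apply: leq_trans (leq_add split_sum (leqnn #|V1|)) _.
rewrite -addnA (addnC (#|B| * #|B|)) addnA leq_add2r.
by apply: leq_trans key (leq_trans le_an _); rewrite leq_add2l.
Qed.

(** An edge through [v] either has all its other vertices in [nbr s H v] or contains one of at most
    [n] pairs at [v] that are not rich, each of small degree. *)
Lemma degree_nbr_leq (n r s : nat) (H : {set {set 'I_n}}) (v : 'I_n) :
  uniform r H -> 1 < r ->
  degree H [set v] <= 'C(#|nbr s H v|, r.-1) + s * n ^ (r - 2).
Proof.
move=> uH r1; have n0 : 0 < n by case: (n) v => [[]|].
pose H1 := [set E in H | (v \in E) && (E :\ v \subset nbr s H v)].
have cH1 : #|H1| <= 'C(#|nbr s H v|, r.-1).
  rewrite -cards_draws; rewrite -(@card_in_imset _ _ (fun E => E :\ v) H1); last first.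
    move=> E D; rewrite !inE => /and3P[_ vE _] /and3P[_ vD _] e.
    by rewrite -(setD1K vE) -(setD1K vD) e.
  apply/subset_leq_card/subsetP=> X /imsetP[E]; rewrite !inE => /and3P[HE vE sE] ->.
  by rewrite sE -(uH _ HE) (cardsD1 v E) vE /= eqxx.
pose N := [set w | (w != v) && ~~ rich s H [set v; w]].
have cover : degree H [set v] <= #|H1| + \sum_(w in N) degree H [set v; w].
  rewrite degree_sum -sum1_card big_mkcond [\sum_(i in H1) 1]big_mkcond.
  under [X in _ + X]eq_bigr do rewrite degree_sum big_mkcond.
  rewrite [X in _ + X]exchange_big /= -big_split /=; apply: leq_sum => E _.
  case: ifP => // HE; rewrite sub1set; case: (boolP (v \in E)) => //= vE.
  rewrite !inE HE vE /=; case: (boolP (_ \subset _)) => // /subsetPn[w].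
  rewrite !inE => /andP[wv wE]; rewrite wv /= => nr.
  have wN : w \in N by rewrite inE wv.
  by rewrite (bigD1 w) //= subUset !sub1set vE wE.
apply: leq_trans cover _; rewrite leq_add // -(leq_pmul2r n0).
rewrite big_distrl /=; apply: leq_trans (_ : \sum_(w in N) s * n ^ (r - 2) <= _).
  apply: leq_sum => w; rewrite inE => /andP[wv nr].
  have c2 : #|[set v; w]| = 2 by rewrite cards2 eq_sym wv.
  by have := degree_not_rich uH _ nr; rewrite c2 => ->.
by rewrite sum_nat_const mulnC leq_mul2l (leq_trans (max_card _)) ?card_ord ?orbT.
Qed.

(** * Heavy sets *)

Definition heavy (n r K : nat) (H : {set {set 'I_n}}) (T : {set 'I_n}) : bool :=
  n ^ (r - #|T|) <= K * degree H T.

Lemma heavy_rich (n r s K : nat) (H : {set {set 'I_n}}) (T : {set 'I_n}) :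
  uniform r H -> #|T| <= r -> K * s < n -> heavy r K H T -> rich s H T.
Proof.
move=> uH cT lt hT; apply/negPn/negP=> nr.
have n0 : 0 < n by apply: leq_ltn_trans lt.
have : n ^ (r - #|T|) * n <= K * s * n ^ (r - #|T|).
  apply: leq_trans (_ : K * (s * n ^ (r - #|T|)) <= _); last by rewrite mulnA.
  apply: leq_trans (_ : K * degree H T * n <= _); first exact: leq_mul hT (leqnn n).
  by rewrite -mulnA leq_mul2l degree_not_rich ?orbT.
by rewrite mulnC leq_pmul2r ?expn_gt0 ?n0 // leqNgt lt.
Qed.

Lemma degree_rich_leq (n r s : nat) (H : {set {set 'I_n}}) (T : {set 'I_n}) :
  uniform r H -> #|T| <= r ->
  degree H T * n <= (rich s H T * n + s) * n ^ (r - #|T|).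
Proof.
move=> uH cT; case: (boolP (rich s H T)) => [_ | /(degree_not_rich uH cT)] //.
rewrite mul1n mulnDl; apply: leq_trans (leq_addr _ _).
by rewrite mulnC leq_mul2l degree_leq_exp ?orbT.
Qed.

(** Sum the degrees of the sets [w |: X]: those that are not rich contribute only lower order, so
    linearly many must be rich. *)
Lemma heavy_extensions (n r s K : nat) (H : {set {set 'I_n}}) (X : {set 'I_n}) :
  uniform r H -> #|X| < r -> heavy r K H X ->
  n <= K * (#|[set w | (w \notin X) && rich s H (w |: X)]| + s).
Proof.
move=> uH cX hX; case: (posnP n) => [e0|n0]; first by rewrite [X in X <= _]e0.
set L := [set w | _].
pose m := r - #|X|.+1.
have em : n ^ (r - #|X|) = n ^ m * n by rewrite -expnSr /m subnS prednK // subn_gt0.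
have le1 : degree H X * n <= (#|L| + s) * n * n ^ m.
  apply: leq_trans (_ : \sum_(w | w \notin X) degree H (w |: X) * n <= _).
    by rewrite -big_distrl /= (sum_degree_setU1 _ uH) leq_mul2r leq_pmull ?orbT // subn_gt0.
  apply: leq_trans (_ : \sum_(w : 'I_n) ((w \in L) * n + s) * n ^ m <= _).
    rewrite big_mkcond; apply: leq_sum => w _; case: ifP => // wX.
    have cw : #|w |: X| = #|X|.+1 by rewrite cardsU1 wX.
    have := @degree_rich_leq n r s H (w |: X) uH; rewrite cw inE wX => h.
    exact: h.
  rewrite -big_distrl /= leq_mul2r big_split /= -big_distrl /= sum_nat_const card_ord.
  rewrite mulnDl (mulnC n) leq_add2r leq_mul2r.
  suff -> : \sum_(w : 'I_n) (w \in L) = #|L| by rewrite leqnn !orbT.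
  by rewrite -sum1_card [RHS]big_mkcond; apply: eq_bigr => w _; case: (w \in L).
rewrite -(@leq_pmul2r (n ^ m * n)) ?muln_gt0 ?expn_gt0 ?n0 //.
rewrite -em; apply: leq_trans (leq_mul (leqnn n) hX) _.
rewrite mulnCA (mulnC n) em; apply: leq_trans (leq_mul (leqnn K) le1) _.
by rewrite -!mulnA leq_mul2l leq_mul2l (mulnC n) leqnn !orbT.
Qed.

(** Ordered pairs are counted because [linked_path] asks for a degree sum. *)
Lemma heavy_extensions2 (n r s K : nat) (H : {set {set 'I_n}}) (X : {set 'I_n}) :
  uniform r H -> #|X| + 2 <= r -> heavy r K H X ->
  n ^ 2 <= K * (\sum_x #|[set y | [&& x \notin X, y \notin X, x != y &
                                   rich s H (y |: (x |: X))]]| + s * n).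
Proof.
move=> uH cX hX; case: (posnP n) => [e0|n0]; first by rewrite [X in X ^ _ <= _]e0.
pose L x := [set y | [&& x \notin X, y \notin X, x != y & rich s H (y |: (x |: X))]].
pose m := r - #|X|.+2.
have em : n ^ (r - #|X|) = n ^ m * n ^ 2 by rewrite -expnD; congr (_ ^ _); rewrite /m; lia.
have le1 : degree H X * n <= (\sum_x #|L x| + s * n) * n * n ^ m.
  apply: leq_trans (_ : \sum_(x | x \notin X) degree H (x |: X) * n <= _).
    by rewrite -big_distrl /= (sum_degree_setU1 _ uH) leq_mul2r leq_pmull ?orbT // subn_gt0; lia.
  have -> : (\sum_x #|L x| + s * n) * n * n ^ m =
     \sum_(x : 'I_n) \sum_(y : 'I_n) ((y \in L x) * n + s) * n ^ m.
    under [RHS]eq_bigr do rewrite -big_distrl /= big_split /= -big_distrl /= sum_nat_const card_ord.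
    rewrite -big_distrl /= big_split /= sum_nat_const card_ord -big_distrl /=.
    rewrite mulnDl; congr ((_ * _ + _) * _); last by lia.
    apply: eq_bigr => x _.
    by rewrite -sum1_card big_mkcond; apply: eq_bigr => w _; case: (w \in L x).
  rewrite big_mkcond; apply: leq_sum => x _; case: ifP => // xX.
  have cx : #|x |: X| = #|X|.+1 by rewrite cardsU1 xX.
  apply: leq_trans (_ : \sum_(y | y \notin x |: X) degree H (y |: (x |: X)) * n <= _).
    by rewrite -big_distrl /= (sum_degree_setU1 _ uH) leq_mul2r leq_pmull ?orbT // subn_gt0 cx; lia.
  rewrite big_mkcond; apply: leq_sum => y _; case: ifP => // yX.
  have cy : #|y |: (x |: X)| = #|X|.+2 by rewrite cardsU1 yX cx.
  have := @degree_rich_leq n r s H (y |: (x |: X)) uH; rewrite cy !inE xX.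
  move: yX; rewrite !inE negb_or eq_sym => /andP[-> ->] h.
  by apply: h; lia.
rewrite -(@leq_pmul2r (n ^ m * n)) ?muln_gt0 ?expn_gt0 ?n0 //.
have -> : n ^ 2 * (n ^ m * n) = n ^ (r - #|X|) * n by rewrite em mulnCA mulnA.
apply: leq_trans (_ : K * degree H X * n <= _); first exact: leq_mul hX (leqnn n).
rewrite -mulnA; apply: leq_trans (leq_mul (leqnn K) le1) _.
by rewrite -!mulnA leq_mul2l leq_mul2l (mulnC n) leqnn !orbT.
Qed.

(** Turns a bound on disjoint subfamilies into a bounded vertex set meeting every member of [C]. *)
Lemma maximal_disjoint (V : finType) (m : nat) (C : {set {set V}}) :
  (forall c, c \in C -> c != set0 /\ #|c| <= m) ->
  exists M : {set {set V}}, [/\ M \subset C, trivIset M, #|cover M| <= m * #|M| &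
    forall c, c \in C -> ~~ [disjoint c & cover M]].
Proof.
move=> hC; pose P (M : {set {set V}}) := (M \subset C) && trivIset M.
have P0 : P set0 by rewrite /P sub0set; apply/trivIsetP=> A B; rewrite inE.
have [M /maxsetP[/andP[sMC tM] maxM] _] := maxset_exists P0.
exists M; split=> //.
  apply: leq_trans (leq_card_cover M) _; rewrite mulnC -sum_nat_const.
  by apply: leq_sum => c /(subsetP sMC)/hC[].
move=> c cC; apply/negP=> dc; have [/negP c0 _] := hC c cC.
have cM A : A \in M -> [disjoint c & A].
  by move=> AM; apply: disjointWr dc; apply: bigcup_sup.
suff /maxM/(_ (subsetUr _ _))/setP/(_ c) : P (c |: M).
  rewrite setU11 => /esym /cM; rewrite -setI_eq0 setIid; exact: c0.
rewrite /P subUset sub1set cC sMC /=; apply/trivIsetP=> A B; rewrite !inE.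
case/orP=> [/eqP-> | AM] /orP[/eqP-> | BM].
- by rewrite eqxx.
- by move=> _; apply: cM.
- by move=> _; rewrite disjoint_sym; apply: cM.
- by move: A B AM BM; apply/trivIsetP.
Qed.

(* Vertices [x], [y] linked through many of the disjoint sets of [M] form a
   dense graph; a path in that graph picks up one new member of [M] per edge. *)
Lemma linked_path (n l kappa : nat) (M : {set {set 'I_n}})
    (R : {set 'I_n} -> rel 'I_n) :
  (forall c, symmetric (R c)) -> trivIset M -> 0 < n -> 4 * kappa * l <= n ->
  2 * kappa * (2 * l + 1) < #|M| ->
  (forall c, c \in M -> n ^ 2 <= kappa * \sum_x #|[set y | R c x y]|) ->
  exists (p : nat -> 'I_n) (c : nat -> {set 'I_n}),
    [/\ forall i j, i < j -> j <= l -> p i != p j,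
        forall i, i < l -> c i \in M /\ R (c i) (p i) (p i.+1),
        forall i j, i < j -> j < l -> [disjoint c i & c j] &
        forall i j, i < l -> j <= l -> p j \notin c i].
Proof.
move=> symR tM n0 nl ltM hM.
pose m x y := #|[set c in M | R c x y]|.
(* Along the path at most [l + 1] members of [M] contain a path vertex and at most [l - 1] are
   already used, so [2 * l + 1] links always leave a choice. *)
pose e : rel 'I_n := [rel x y | 2 * l + 1 <= m x y].
have se : symmetric e.
  move=> x y; rewrite /e /= /m; congr (_ <= _); apply: eq_card => c.
  by rewrite !inE symR.
have sum_m : \sum_(c in M) \sum_x #|[set y | R c x y]| = \sum_x \sum_y m x y.
  rewrite exchange_big; apply: eq_bigr => x _ /=.
  under eq_bigr do rewrite -sum1dep_card big_mkcond.
  rewrite exchange_big; apply: eq_bigr => y _ /=.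
  rewrite /m -sum1_card -big_mkcondr; apply: eq_bigl => c; by rewrite !inE.
have le_m : \sum_x \sum_y m x y <= \sum_x #|[set y | e x y]| * #|M| + n ^ 2 * (2 * l + 1).
  have -> : n ^ 2 * (2 * l + 1) = \sum_(x < n) \sum_(y < n) (2 * l + 1).
    by rewrite !sum_nat_const !card_ord mulnA.
  rewrite -big_split /=; apply: leq_sum => x _.
  rewrite -sum1dep_card [X in X * _]big_mkcond big_distrl -big_split /=; apply: leq_sum => y _.
  case: ifP => [_ | /negbT]; last by rewrite -ltnNge => /ltnW.
  rewrite mul1n; apply: leq_trans (leq_addr _ _).
  by apply/subset_leq_card/subsetP=> c; rewrite inE => /andP[].
have lt_e : 2 * l * n < \sum_x #|[set y | e x y]|.
  rewrite ltnNge; apply/negP=> le_e.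
  have : #|M| * n ^ 2 <= kappa * (2 * l * n * #|M| + n ^ 2 * (2 * l + 1)).
    rewrite -sum_nat_const; apply: leq_trans (_ : \sum_(c in M) kappa * \sum_x #|[set y | R c x y]| <= _).
      exact: leq_sum.
    rewrite -big_distrr /= sum_m leq_mul2l (leq_trans le_m) ?orbT //.
    by rewrite leq_add2r -big_distrl leq_mul2r le_e orbT.
  (* Each of the two terms on the right is at most half of [#|M| * n ^ 2], the second strictly
     less. *)
  have h1 : #|M| * n * (4 * kappa * l) <= #|M| * n * n by rewrite leq_mul2l nl orbT.
  have h2 : 2 * kappa * (2 * l + 1) * n ^ 2 < #|M| * n ^ 2.
    by rewrite ltn_pmul2r // expn_gt0 n0.
  move: h1 h2; nia.
have [q [sq uq eq]] := graph_path se lt_e.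
case: q sq uq eq => [|v0 q] // [sq] uq eq.
pose p i := nth v0 (v0 :: q) i.
have pq i : i <= l -> p i \in v0 :: q by move=> il; apply: mem_nth; rewrite /= sq.
have pe i : i < l -> e (p i) (p i.+1).
  by move=> il; apply: (pathP v0 eq); rewrite sq.
have few : #|[set c in M | [exists x in v0 :: q, x \in c]]| <= l.+1.
  have hit x : #|[set c in M | x \in c]| <= 1.
    apply/card_le1_eqP=> c d; rewrite !inE => /andP[cM xc] /andP[dM xd].
    by rewrite -(def_pblock tM cM xc) -(def_pblock tM dM xd).
  have -> : l.+1 = \sum_(x <- v0 :: q) 1 by rewrite big_const_seq count_predT iter_addn_0 mul1n /= sq.
  apply: leq_trans (_ : \sum_(x <- v0 :: q) #|[set c in M | x \in c]| <= _); last by apply: leq_sum => x _; exact: hit.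
  under [X in _ <= X]eq_bigr do rewrite -sum1_card big_mkcond.
  rewrite exchange_big /= -sum1_card big_mkcond; apply: leq_sum => c _.
  case: ifP => //; rewrite inE => /andP[cM /existsP[x /andP[xq xc]]].
  by rewrite (big_rem x xq) /= inE cM xc.
have pick k : k <= l -> exists cs : seq {set 'I_n}, [/\ size cs = k, uniq cs,
    {subset cs <= M}, (forall i, i < k -> R (nth set0 cs i) (p i) (p i.+1)) &
    forall c x, c \in cs -> x \in v0 :: q -> x \notin c].
  elim: k => [_ | k IH kl]; first by exists [::].
  have [cs [scs ucs csM Rcs ncs]] := IH (ltnW kl).
  pose bad := [set c in M | [exists x in v0 :: q, x \in c]] :|: [set c in cs].
  have [c] : exists c, c \in [set c in M | R c (p k) (p k.+1)] :\: bad.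
    apply/set0Pn; rewrite -card_gt0 cardsD subn_gt0.
    apply: leq_trans (pe k kl); rewrite addn1 ltnS.
    apply: leq_trans (subset_leq_card (subsetIr _ _)) _.
    apply: leq_trans (_ : l.+1 + k <= _); last by lia.
    apply: leq_trans (_ : #|[set c in M | [exists x in v0 :: q, x \in c]]| + #|[set c in cs]| <= _).
      by rewrite -cardsUI leq_addr.
    by rewrite leq_add // cardsE -scs card_size.
  rewrite !inE negb_or => /andP[/andP[nbad ncs'] /andP[cM Rc]].
  rewrite cM /= in nbad.
  exists (rcons cs c); split.
  - by rewrite size_rcons scs.
  - by rewrite rcons_uniq ncs'.
  - by move=> d; rewrite mem_rcons inE => /orP[/eqP-> // | /csM].
  - move=> i; rewrite ltnS leq_eqVlt nth_rcons scs => /orP[/eqP-> | ik].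
      by rewrite ltnn eqxx.
    by rewrite ik; apply: Rcs.
  - move=> d x; rewrite mem_rcons inE => /orP[/eqP-> xq | dcs]; last exact: ncs.
    by have /existsPn/(_ x) := nbad; rewrite xq.
have [cs [scs ucs csM Rcs ncs]] := pick l (leqnn l).
have csi i : i < l -> nth set0 cs i \in cs by move=> il; rewrite mem_nth ?scs.
exists p, (nth set0 cs); split.
- by move=> i j ij jl; rewrite /p nth_uniq //= ?sq; lia.
- by move=> i il; split; [apply/csM/csi | apply: Rcs].
- move=> i j ij jl; have il : i < l by lia.
  move/trivIsetP: tM; apply; try exact/csM/csi.
  by rewrite nth_uniq ?scs //; lia.
- by move=> i j il jl; apply: ncs; [apply: csi | apply: pq].
Qed.

(** As [3 < r], a heavy pair can be enlarged by two vertices: the sets [c i] with [p i] and [p i.+1]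
    added are rich quadruples, consecutive ones sharing just [p i.+1]. *)
Lemma card_disjoint_heavy_pairs (n r s l K : nat) (H M : {set {set 'I_n}}) :
  uniform r H -> 3 < r -> r * l <= s -> ~ has_path l H -> 0 < n ->
  2 * K * s <= n -> 8 * K * l <= n -> trivIset M ->
  (forall T, T \in M -> #|T| = 2 /\ heavy r K H T) ->
  #|M| <= 4 * K * (2 * l + 1).
Proof.
move=> uH r3 rls np n0 ns nl tM hM; rewrite leqNgt; apply/negP=> ltM; apply: np.
pose R (T : {set 'I_n}) : rel 'I_n := [rel x y |
  [&& x \notin T, y \notin T, x != y & rich s H (y |: (x |: T))]].
have [|||c cM|p [c [pinj cR cd pc]]] := @linked_path n l (2 * K) M R _ tM n0.
- by move=> T x y; rewrite /R /= setUCA eq_sym; case: (x \in T); case: (y \in T).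
- by apply: leq_trans nl; lia.
- by apply: leq_trans ltM; lia.
- have [c2 hc] := hM c cM; have := @heavy_extensions2 n r s K H c uH.
  rewrite c2 => /(_ r3 hc) h.
  have h2 : 2 * K * s * n <= n ^ 2 by rewrite -mulnn leq_mul2r ns orbT.
  move: h h2; rewrite /R /=; set Z := \sum_x _; lia.
apply: (rich_skeleton (S := fun i => p i.+1 |: (p i |: c i)) uH rls); last first.
- by move=> i il; have [_ /and4P[]] := cR i il.
- move=> i il; have [cM /and4P[pi pi' pp _]] := cR i il.
  rewrite !cardsU1 pi !inE negb_or eq_sym pp pi' /= (proj1 (hM _ cM)); lia.
have pn i j : i <= l -> j <= l -> i != j -> p i != p j.
  move=> il jl; rewrite neq_ltn => /orP[ij | ji]; first exact: pinj.
  by rewrite eq_sym; apply: pinj.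
have cc i j x : i < j -> j < l -> x \in c i -> x \in c j = false.
  by move=> ij jl xi; have /disjointFr -> := cd i j ij jl.
split=> [i il | i j ij jl].
  apply/eqP/cards1P; exists (p i.+1); apply/setP=> x; rewrite !inE.
  apply/andP/eqP=> [[] | ->]; last by rewrite eqxx orbT.
  case/or3P=> [/eqP-> // | /eqP-> | xc].
    rewrite (negbTE (pn i i.+2 _ _ _)) 1?(negbTE (pn i i.+1 _ _ _)) 1?(negbTE (pc i.+1 i _ _)) //; lia.
  case/or3P=> [/eqP e | /eqP-> // | ].
    by have := pc i i.+2; rewrite -e xc => h; have := h (ltnW il) il.
  by rewrite (cc i i.+1).
rewrite -setI_eq0; apply/eqP/setP=> x; rewrite !inE; apply/negP=> /andP[].
case/or3P=> [/eqP-> | /eqP-> | xc].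
- by rewrite (negbTE (pn i.+1 j.+1 _ _ _)) 1?(negbTE (pn i.+1 j _ _ _)) 1?(negbTE (pc j i.+1 _ _)) //; lia.
- by rewrite (negbTE (pn i j.+1 _ _ _)) 1?(negbTE (pn i j _ _ _)) 1?(negbTE (pc j i _ _)) //; lia.
case/or3P=> [/eqP e | /eqP e | ].
- by have /negP[] := pc i j.+1 (ltn_trans (ltnW ij) jl) jl; rewrite -e.
- by have /negP[] := pc i j (ltn_trans (ltnW ij) jl) (ltnW jl); rewrite -e.
by rewrite (cc i j) //; lia.
Qed.

(** Otherwise deletions leave a subfamily whose covered vertices have degree above about
    [n^(t-2) / e]. A vertex not rich there would lie in a pair of degree of order [n^(t-2)], which
    heaviness of the [t]-sets makes heavy in [H]; so the greedy path exists. *)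
Lemma card_heavy_no_heavy_pair (n r s l t e K K2 : nat) (H F : {set {set 'I_n}}) :
  uniform r H -> 1 < t -> t <= r -> r * l <= s -> ~ has_path l H ->
  0 < e -> 0 < K -> 0 < s -> K * s < n -> e * (s * K * 2 ^ r) <= K2 ->
  (forall T, T \in F -> #|T| = t /\ heavy r K H T) ->
  (forall T P : {set 'I_n}, T \in F -> P \subset T -> #|P| = 2 -> ~~ heavy r K2 H P) ->
  e * #|F| <= n ^ t.-1.
Proof.
move=> uH t1 tr rls np e0 K0 s0 ns hK2 hF nF.
have n0 : 0 < n by apply: leq_ltn_trans ns.
pose c := n ^ (t - 2) %/ e.
have et : n ^ t.-1 = n ^ (t - 2) * n by rewrite -expnSr; congr (_ ^ _); lia.
suff leF : #|F| <= c * n.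
  rewrite et; apply: leq_trans (_ : e * (c * n) <= _); first by rewrite leq_mul2l leF orbT.
  by rewrite mulnA leq_mul2r mulnC leq_trunc_div orbT.
rewrite leqNgt; apply/negP=> ltF.
have [|F' [sF' nF' hF']] := @dense_subfamily n 1 c F.
  apply: leq_ltn_trans ltF; rewrite leq_mul2l; apply/orP; right.
  apply: (@leq_trans 'C(#|[set: 'I_n]|, 1)); last by rewrite bin1 cardsT card_ord.
  rewrite -cards_draws.
  by apply/subset_leq_card/subsetP=> X; rewrite !inE subsetT => /andP[].
have uF' : uniform t F' by move=> T /(subsetP sF')/hF[].
have uF : uniform t F by move=> T /hF[].
have npF : ~ has_path l F.
  apply: (rich_family_no_path uH uF tr rls _ np) => T /hF[cT hT].
  by apply: heavy_rich hT; rewrite ?cT.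
have tls : t * l <= s := leq_trans (leq_mul tr (leqnn l)) rls.
case: npF; have [|S skS SF] := @greedy_path n t s l F' uF' t1 nF' tls.
- move=> E y FE yE; apply/negPn/negP=> /not_rich_transversal[W [cW dW hit le_sum]].
  have ltc : n ^ (t - 2) < degree F' [set y] * e.
    by rewrite -ltn_divLR //; apply: (hF' E); rewrite ?sub1set ?cards1.
  have pair_le w : w \in W -> K2 * degree F' (w |: [set y]) <= K * 2 ^ r * n ^ (t - 2).
    move=> wW; set P := w |: [set y].
    have cP : #|P| = 2.
      rewrite cards2; have -> // : w != y.
      by apply: contraTneq dW => wy; rewrite -setI_eq0; apply/set0Pn; exists y; rewrite !inE eqxx -wy.
    case: (posnP (degree F' P)) => [-> | ]; first by rewrite muln0.
    case/card_gt0P=> T; rewrite inE => /andP[TF' sPT].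
    have := nF T P (subsetP sF' _ TF') sPT cP; rewrite /heavy cP -ltnNge => nhP.
    rewrite -(@leq_pmul2r (n ^ (r - t))) ?expn_gt0 ?n0 //.
    (* Every [t]-set of [F'] over [P] lies in at least [n^(r-t) / K] members of [H], and a member is
       counted at most [2 ^ r] times. *)
    have h1 : n ^ (r - t) * degree F' P <= K * (2 ^ r * degree H P).
      rewrite mulnC degree_sum big_distrl /=.
      apply: leq_trans (_ : \sum_(T0 : {set 'I_n} | (#|T0| == t) && (P \subset T0)) K * degree H T0 <= _).
        rewrite big_mkcond [X in _ <= X]big_mkcond; apply: leq_sum => T0 _.
        case: ifP => // T0F; have [cT0 hT0] := hF T0 (subsetP sF' _ T0F).
        rewrite cT0 eqxx /=; case: (P \subset T0) => //.
        by rewrite mul1n -cT0.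
      rewrite -big_distrr /= leq_mul2l (sum_degree_containing uH) ?cP // leq_mul2r.
      apply/orP; right; apply/orP; right; apply: leq_trans (_ : 2 ^ (r - 2) <= _); last by rewrite leq_pexp2l ?leq_subr.
      exact: bin_leq_exp2.
    have -> : K * 2 ^ r * n ^ (t - 2) * n ^ (r - t) = K * 2 ^ r * n ^ (r - 2).
      by rewrite -mulnA -expnD; congr (_ * _ ^ _); nat_lia.
    apply: leq_trans (_ : K2 * (K * (2 ^ r * degree H P)) <= _).
      by rewrite -mulnA leq_mul2l (mulnC (degree _ _)) h1 orbT.
    rewrite mulnCA -mulnA leq_mul2l mulnCA leq_mul2l (ltnW nhP) !orbT //.
  have : K2 * degree F' [set y] <= s * (K * 2 ^ r * n ^ (t - 2)).
    apply: leq_trans (leq_mul (leqnn K2) le_sum) _; rewrite big_distrr /=.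
    apply: leq_trans (_ : \sum_(w in W) K * 2 ^ r * n ^ (t - 2) <= _); first exact: leq_sum.
    by rewrite sum_nat_const leq_mul2r cW orbT.
  apply/negP; rewrite -ltnNge.
  apply: leq_trans (leq_mul hK2 (leqnn (degree F' [set y]))).
  have -> : e * (s * K * 2 ^ r) * degree F' [set y] = s * K * 2 ^ r * (degree F' [set y] * e) by lia.
  have -> : s * (K * 2 ^ r * n ^ (t - 2)) = s * K * 2 ^ r * n ^ (t - 2) by lia.
  by rewrite ltn_pmul2l // !muln_gt0 s0 K0 expn_gt0.
by exists S => // i il; apply: (subsetP sF'); apply: SF.
Qed.

(** Two heavy pairs sharing the middle vertex [y]: the configuration that still chains when only one
    vertex can be added to a pair. *)
Definition cherry (n r K : nat) (H : {set {set 'I_n}}) (c : {set 'I_n})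
    (xyz : 'I_n * 'I_n * 'I_n) : bool :=
  let: (x, y, z) := xyz in
  [&& c == [set x; y; z], x != y, y != z, x != z,
      heavy r K H [set x; y] & heavy r K H [set y; z]].

(** The rich triples [{u, x, y}] and [{v, y, z}] meet in [y] alone and thus form two consecutive
    sets leading from [u] to [v]. *)
Definition cherry_link (n s : nat) (H : {set {set 'I_n}}) (c : {set 'I_n})
    (u v : 'I_n) (xyz : 'I_n * 'I_n * 'I_n) : bool :=
  let: (x, y, z) := xyz in
  [&& c == [set x; y; z], x != y, y != z, x != z, u \notin c, v \notin c,
      u != v, rich s H (u |: [set x; y]) & rich s H (v |: [set y; z])].

Lemma card_disjoint_cherries (n r s l K : nat) (H M : {set {set 'I_n}}) :
  uniform r H -> 2 < r -> r * l <= s -> ~ has_path l H -> 0 < n ->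
  2 * K * (s + 2) <= n -> 16 * K ^ 2 * l <= n -> trivIset M ->
  (forall c, c \in M -> exists xyz, cherry r K H c xyz) ->
  #|M| <= 8 * K ^ 2 * (2 * l + 1).
Proof.
move=> uH r2 rls np n0 ns nl tM hM; rewrite leqNgt; apply/negP=> ltM; apply: np.
pose R (c : {set 'I_n}) : rel 'I_n := [rel u v | [exists xyz, cherry_link s H c u v xyz]].
have swap c u v : R c u v -> R c v u.
  case/existsP=> [[[x y] z] /and5P[/eqP ec xy yz xz /and5P[uc vc uv r1 r3]]].
  apply/existsP; exists (z, y, x); rewrite /cherry_link (eq_sym z y) yz (eq_sym y x) xy (eq_sym z x) xz vc uc (eq_sym v u) uv.
  rewrite (setUC [set z]) r3 (setUC [set y] [set x]) r1 ec !andbT; apply/eqP/setP=> w; rewrite !inE.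
  by case: (w == x); case: (w == y); case: (w == z).
(* [4 * K ^ 2]: each of [u] and [v] has at least [n / (2 * K)] choices. *)
have [|||c cM|p [c [pinj cR cd pc]]] := @linked_path n l (4 * K ^ 2) M R _ tM n0.
- by move=> c u v; apply/idP/idP; exact: swap.
- by apply: leq_trans nl; lia.
- by apply: leq_trans ltM; lia.
- have [[[x y] z] /and5P[/eqP ec xy yz xz /andP[hxy hyz]]] := hM c cM.
  have c2 u v : u != v -> #|[set u; v]| = 2 by move=> uv; rewrite cards2 uv.
  have := @heavy_extensions n r s K H [set x; y] uH; have := @heavy_extensions n r s K H [set y; z] uH.
  rewrite !c2 //; set Q := [set _ | _]; set P := [set _ | _] => /(_ r2 hyz) hQ /(_ r2 hxy) hP.
  have h1 : (#|P| - 1) * (#|Q| - 2) <= \sum_u #|[set v | R c u v]|.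
    apply: leq_trans (_ : \sum_(u in P :\ z) (#|Q| - 2) <= _).
      rewrite sum_nat_const leq_mul // (cardsD1 z P) leq_subLR leq_add2r; exact: leq_b1.
    rewrite big_mkcond; apply: leq_sum => u _; case: ifP => //.
    rewrite !inE !negb_or => /and3P[uz /andP[ux uy] ru].
    apply: leq_trans (_ : #|(Q :\ x) :\ u| <= _).
      rewrite leq_subLR (cardsD1 x Q) (cardsD1 u (Q :\ x)) addnA leq_add2r.
      exact: leq_add (leq_b1 _) (leq_b1 _).
    apply/subset_leq_card/subsetP=> v; rewrite !inE !negb_or => /and4P[vu vx /andP[vy vz] rv].
    apply/existsP; exists (x, y, z); rewrite /cherry_link ec eqxx xy yz xz !inE !negb_or.
    by rewrite ux uy uz vx vy vz eq_sym vu ru rv.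
  apply: leq_trans (leq_mul (leqnn _) h1).
  have h2 : n <= 2 * K * (#|P| - 1) by nia.
  have h3 : n <= 2 * K * (#|Q| - 2) by nia.
  have := leq_mul h2 h3; rewrite -mulnn; lia.
(* The default triple is never taken for [i < l]. *)
pose T i := odflt (p 0, p 0, p 0) [pick xyz | cherry_link s H (c i) (p i) (p i.+1) xyz].
have hT i : i < l -> cherry_link s H (c i) (p i) (p i.+1) (T i).
  move=> il; rewrite /T; case: pickP => //= h; have [_ /existsP[xyz]] := cR i il.
  by rewrite h.
(* For the [j]-th cherry, set [2 * j] of the path is [{p j, x, y}] and set [2 * j + 1] is
   [{p j.+1, y, z}]; consecutive sets share [y] and [p j.+1] in turn. *)
pose D i := if odd i then [set (T i./2).1.2; (T i./2).2] else [set (T i./2).1.1; (T i./2).1.2].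
pose S i := p (uphalf i) |: D i.
have sD i : i./2 < l -> D i \subset c i./2.
  move=> /hT; rewrite /D; case: (T _) => [[x y] z] /= /andP[/eqP-> _].
  by case: (odd i); apply/subsetP=> w; rewrite !inE => /orP[]->; rewrite ?orbT.
have pD i j : i./2 < l -> j <= l -> p j \notin D i.
  by move=> il jl; apply: contra (pc _ _ il jl); apply: (subsetP (sD i il)).
have DD i j x : i./2 < j./2 -> j./2 < l -> x \in D i -> x \in D j = false.
  move=> ij jl xi; apply/negP=> /(subsetP (sD j jl)) xj.
  have il : i./2 < l by apply: ltn_trans jl.
  by have /disjointFr/(_ (subsetP (sD i il) x xi)) := cd _ _ ij jl; rewrite xj.
have pn i j : i <= l -> j <= l -> i != j -> (p i == p j) = false.
  move=> il jl; rewrite neq_ltn => /orP[ij | ji]; apply/negbTE; first exact: pinj.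
  by rewrite eq_sym; apply: pinj.
apply: (rich_skeleton (S := S) uH rls); last first.
- move=> i il; have il2 : i./2 < l by lia.
  have := hT _ il2; rewrite /S /D uphalf_half; case: (T _) => [[x y] z] /=.
  by case/and5P=> _ _ _ _ /and5P[_ _ _]; case: (odd i).
- move=> i il; apply: leq_trans r2; apply: leq_trans (_ : 1 + #|D i| <= _).
    by rewrite cardsU1; case: (_ \notin _).
  by rewrite /D; case: (odd i); rewrite cards2; case: (_ != _).
split=> [i il | i j ij jl].
  case: (boolP (odd i)) => oi.
    have e1 : uphalf i.+1 = uphalf i by lia.
    apply/eqP/cards1P; exists (p (uphalf i)); apply/setP=> x; rewrite /S e1 !inE.
    case: eqP => //= _; apply/negP=> /andP[xi].
    by rewrite (DD i) //; lia.
  have eh : uphalf i = i./2 by lia.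
  have il2 : i./2 < l by lia.
  apply/eqP/cards1P; exists (T i./2).1.2; apply/setP=> x.
  have := pD i i./2.+1 il2 il2.
  have : p i./2 \notin D i.+1 by apply: pD; lia.
  have := pn i./2 i./2.+1 (ltnW il2) il2 _; move/(_ ltac:(lia)).
  have e2 : i.+1./2 = i./2 by lia.
  have e3 : uphalf i.+1 = i./2.+1 by lia.
  rewrite /S /D e2 e3 eh [odd i.+1]/= oi (negbTE oi) /= => npp.
  move: npp (hT _ il2); case: (T _) => [[u v] w] /= pp /and5P[_ uv vw uw _].
  rewrite !inE !negb_or => /andP[pv pw] /andP[pu' pv'].
  apply/andP/eqP=> [[/or3P[]/eqP-> /or3P[]/eqP e] | ->] //; last by rewrite !eqxx !orbT.
  - by rewrite e eqxx in pp.
  - by rewrite e eqxx in pw.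
  - by rewrite e eqxx in pu'.
  - by rewrite e eqxx in uw.
rewrite -setI_eq0; apply/eqP/setP=> x; rewrite !inE; apply/negP=> /andP[].
have il2 : i./2 < l by lia.
have jl2 : j./2 < l by lia.
case/orP=> [/eqP-> | xi] /orP[/eqP e | xj].
- by move/eqP: e; rewrite pn //; lia.
- by move: xj; rewrite (negbTE (pD j _ _ _)) //; lia.
- by move: xi; rewrite e (negbTE (pD i _ _ _)) //; lia.
- by move: xj; rewrite (DD i) //; lia.
Qed.

Lemma card_pairs_meeting_leq (n s q : nat) (H F : {set {set 'I_n}})
    (B C : {set 'I_n}) :
  (forall v, v \notin B -> q * #|nbr s H v| <= n) ->
  (forall T, T \in F -> [/\ #|T| = 2, rich s H T & [disjoint T & B]]) ->
  q * #|[set T in F | ~~ [disjoint T & C]]| <= #|C| * n.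
Proof.
move=> hB hF; set A := [set T in F | _].
have cA : #|A| <= \sum_(y in C) #|[set T in F | y \in T]|.
  under eq_bigr do rewrite -sum1_card big_mkcond.
  rewrite exchange_big /= -sum1_card big_mkcond /=; apply: leq_sum => T _.
  case: ifP => //; rewrite inE => /andP[FT /pred0Pn[y /andP[/= yT yC]]].
  by rewrite (bigD1 y) //= inE FT yT.
apply: leq_trans (leq_mul (leqnn q) cA) _; rewrite big_distrr -sum_nat_const /=.
apply: leq_sum => y _; case: (boolP (y \in B)) => yB.
  rewrite (_ : [set T in F | y \in T] = set0) ?cards0 ?muln0 //.
  apply/setP=> T; rewrite !inE; apply/negP=> /andP[/hF[_ _ dTB] yT].
  by move/disjointFr: dTB => /(_ y yT); rewrite yB.
apply: leq_trans (hB y yB); rewrite leq_mul2l; apply/orP; right.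
apply: leq_trans (leq_imset_card (fun z => [set y; z]) (nbr s H y)).
apply/subset_leq_card/subsetP=> T; rewrite inE => /andP[/hF[c2 rT _] yT].
have /cards2P[u [v [uv eT]]] : #|T| == 2 by rewrite c2.
move: yT; rewrite eT !inE => /orP[]/eqP ey.
  by apply/imsetP; exists v; rewrite ey // inE eq_sym uv -eT.
by apply/imsetP; exists u; rewrite ey; [rewrite inE uv setUC -eT | rewrite setUC].
Qed.

Lemma card_pairs_containing_leq (n t : nat) (F Q : {set {set 'I_n}}) :
  1 < t -> (forall T, T \in F -> #|T| = t) -> (forall P, P \in Q -> #|P| = 2) ->
  #|[set T in F | [exists P in Q, P \subset T]]| <= #|Q| * n ^ (t - 2).
Proof.
move=> t1 hF hQ.
apply: leq_trans (_ : \sum_(P in Q) #|[set T in F | P \subset T]| <= _).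
  under [X in _ <= X]eq_bigr do rewrite -sum1_card big_mkcond.
  rewrite exchange_big /= -sum1_card big_mkcond /=; apply: leq_sum => T _.
  case: ifP => //; rewrite inE => /andP[FT /existsP[P /andP[PQ sPT]]].
  by rewrite (bigD1 P) //= inE FT sPT.
rewrite -sum_nat_const; apply: leq_sum => P PQ.
by have := @degree_leq_exp n t F P hF; rewrite hQ // => /(_ t1).
Qed.

(* For [(r, t) = (3, 2)] the heavy pairs avoiding [B] may form a perfect
   matching; apart from a bounded number of vertices they form nothing else. *)
Lemma card_heavy_pairs_off_leq (n r s l q K : nat) (H : {set {set 'I_n}})
    (B : {set 'I_n}) (F := [set T : {set 'I_n} |
      [&& #|T| == 2, heavy r K H T & [disjoint T & B]]]) :
  uniform r H -> 2 < r -> r * l <= s -> ~ has_path l H -> K * s < n ->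
  2 * K * (s + 2) <= n -> 16 * K ^ 2 * l <= n ->
  (forall v, v \notin B -> q * #|nbr s H v| <= n) ->
  q * (2 * #|F|) <= q * #|cover F| + 48 * K ^ 2 * (2 * l + 1) * n.
Proof.
move=> uH r2 rls np ns ns2 nl hB.
have n0 : 0 < n by apply: leq_ltn_trans ns.
pose C := [set c : {set 'I_n} | [disjoint c & B] && [exists xyz, cherry r K H c xyz]].
have C3 c : c \in C -> c != set0 /\ #|c| <= 3.
  rewrite inE => /andP[_ /existsP[[[x y] z] /andP[/eqP-> _]]]; split.
    by apply/set0Pn; exists x; rewrite !inE eqxx.
  apply: leq_trans (_ : #|[set x; y]| + #|[set z]| <= _); first by rewrite -cardsUI leq_addr.
  by rewrite cards1 cards2; case: (_ != _).
have [M [sMC tM cM hM]] := maximal_disjoint C3.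
have leM : #|M| <= 8 * K ^ 2 * (2 * l + 1).
  apply: (card_disjoint_cherries uH r2 rls np n0 ns2 nl tM) => c /(subsetP sMC).
  by rewrite inE => /andP[_ /existsP].
have hF T : T \in F -> [/\ #|T| = 2, rich s H T & [disjoint T & B]].
  rewrite inE => /and3P[/eqP c2 hT dT]; split=> //.
  by apply: heavy_rich hT => //; rewrite c2 ltnW.
have leA := card_pairs_meeting_leq (cover M) hB hF.
set F3 := [set T in F | _] in leA.
pose F2 := [set T in F | [disjoint T & cover M]].
have eF : #|F| = #|F2| + #|F3|.
  rewrite -(cardsID [set T : {set 'I_n} | [disjoint T & cover M]] F).
  by congr (_ + _); apply: eq_card => T; rewrite !inE // andbC.
(* Two intersecting pairs of [F2] would form a cherry disjoint from [B] and from [cover M], against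
   maximality. *)
have tF2 : trivIset F2.
  apply/trivIsetP=> T T' TF2 T'F2 nTT'.
  rewrite -setI_eq0; apply/eqP/setP=> y; rewrite !inE; apply/negP=> /andP[yT yT'].
  have sF2 U : U \in F2 -> [/\ #|U| == 2, heavy r K H U, [disjoint U & B] & [disjoint U & cover M]].
    by rewrite inE => /andP[]; rewrite inE => /and3P[].
  have [c2 hT dT dTM] := sF2 T TF2; have [c2' hT' dT' dTM'] := sF2 T' T'F2.
  have other (U : {set 'I_n}) : #|U| == 2 -> y \in U -> exists2 x, x != y & U = [set x; y].
    case/cards2P=> u [v [uv ->]]; rewrite !inE => /orP[]/eqP->.
      by exists v; rewrite 1?eq_sym // setUC.
    by exists u.
  have [x xy eT] := other T c2 yT; have [z zy eT'] := other T' c2' yT'.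
  have xz : x != z by apply: contraNneq nTT' => e; rewrite eT eT' e.
  have /hM/negP[] : [set x; y; z] \in C.
    rewrite inE; apply/andP; split.
      rewrite -setI_eq0; apply/eqP/setP=> w; rewrite !inE; apply/negP=> /andP[hw wB].
      have : (w \in T) || (w \in T') by rewrite eT eT' !inE; case/orP: hw => ->; rewrite ?orbT.
      by case/orP=> [/(disjointFr dT)|/(disjointFr dT')]; rewrite wB.
    apply/existsP; exists (x, y, z); rewrite /cherry eqxx xy (eq_sym y) zy xz /=.
    by rewrite -eT hT (setUC [set y]) -eT' hT'.
  rewrite -setI_eq0; apply/eqP/setP=> w; rewrite !inE; apply/negP=> /andP[hw wM].
  have : (w \in T) || (w \in T') by rewrite eT eT' !inE; case/orP: hw => ->; rewrite ?orbT.
  by case/orP=> [/(disjointFr dTM)|/(disjointFr dTM')]; rewrite wM.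
have le2 : 2 * #|F2| <= #|cover F|.
  apply: (@leq_trans #|cover F2|).
    rewrite -(eqP tF2) mulnC -sum_nat_const; apply: leq_sum => T.
    by rewrite inE => /andP[/hF[-> _ _]].
  apply/subset_leq_card/subsetP=> y /bigcupP[T]; rewrite inE => /andP[TF _] yT.
  by apply/bigcupP; exists T.
rewrite eF mulnDr mulnDr leq_add ?leq_mul2l ?le2 ?orbT // mulnCA.
apply: leq_trans (leq_mul (leqnn 2) leA) _.
have : #|cover M| <= 3 * (8 * K ^ 2 * (2 * l + 1)) by apply: leq_trans cM _; rewrite leq_mul2l leM.
by move=> h; rewrite mulnA leq_mul2r; apply/orP; right; lia.
Qed.

(** [V1] is the vertex set of the heavy pairs off [B] when [(r, t) = (3, 2)], each vertex accounting
    for half a pair, and is empty in all other cases. The threshold [q] defining [B] is chosen after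
    [e] and [K]. *)
Lemma card_heavy_off_leq (r t s l e K : nat) :
  2 < r -> 0 < t -> t < r -> 0 < l -> r * l <= s -> 0 < e -> 0 < K ->
  exists q N, 0 < q /\ forall n, N <= n -> forall H : {set {set 'I_n}},
    uniform r H -> ~ has_path l H ->
    let B := [set v | n <= q * #|nbr s H v|] in
    exists V1 : {set 'I_n},
      (forall w, w \in V1 -> w \notin B /\ exists2 z, z \in nbr s H w & z \notin B) /\
      2 * (t.-1)`! * e * #|[set T : {set 'I_n} |
            [&& #|T| == t, heavy r K H T & [disjoint T & B]]]| * n
        <= (e * #|V1| + n) * n ^ t.-1.
Proof.
move=> r2 t0 tr l0 rls e0 K0.
have s0 : 0 < s by apply: leq_trans rls; rewrite muln_gt0 l0 andbT; lia.
have hB n q (H : {set {set 'I_n}}) v :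
    v \notin [set v | n <= q * #|nbr s H v|] -> q * #|nbr s H v| <= n.
  by rewrite inE -ltnNge => /ltnW.
case: (ltngtP t 1) => [|t1|t1]; first by lia.
- case: (ltngtP r 3) => [|r3|r3]; first by lia.
  (* Half of the allowance goes to the [t]-sets containing a heavy pair and half to those containing
     none. *)
  + pose e' := 4 * (t.-1)`! * e; pose K2 := e' * (s * K * 2 ^ r).
    have e'0 : 0 < e' by rewrite !muln_gt0 fact_gt0 e0.
    have K20 : 0 < K2 by rewrite /K2 muln_gt0 e'0 muln_gt0 muln_gt0 s0 K0 expn_gt0.
    (* [D] bounds the vertices covered by disjoint heavy pairs. Each such vertex off [B] lies in at
       most [n / q] heavy pairs off [B], hence [q = e' * D] leaves at most [n / e'] of them. *)
    pose D := 8 * K2 * (2 * l + 1).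
    have D0 : 0 < D by rewrite /D muln_gt0 addn_gt0 orbT andbT muln_gt0 K20.
    exists (e' * D), (8 * K2 * l + 2 * K2 * s + K * s + 1); split.
      by rewrite muln_gt0 e'0 D0.
    move=> n Nn H uH np B; exists set0; split=> [w|]; first by rewrite inE.
    set F := [set T | _]; rewrite cards0 muln0 add0n.
    have n0 : 0 < n by lia.
    pose Q := [set P : {set 'I_n} | [&& #|P| == 2, heavy r K2 H P & [disjoint P & B]]].
    have hQ P : P \in Q -> [/\ #|P| = 2, rich s H P & [disjoint P & B]].
      rewrite inE => /and3P[/eqP c2 hP dP]; split=> //.
      by apply: heavy_rich hP => //; rewrite ?c2; lia.
    have [|M [sMQ tM cM hM]] := @maximal_disjoint _ 2 Q.
      by move=> P /hQ[c2 _ _]; rewrite -cards_eq0 c2.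
    have leM : #|M| <= 4 * K2 * (2 * l + 1).
      apply: (@card_disjoint_heavy_pairs n r s l K2 H) => //; try lia.
      by move=> P /(subsetP sMQ); rewrite inE => /and3P[/eqP-> ->].
    have leQ : e' * #|Q| <= n.
      have := card_pairs_meeting_leq (cover M) (hB n _ H) hQ.
      rewrite (_ : [set T in Q | _] = Q); last first.
        by apply/setP=> P; rewrite inE; case: (boolP (P \in Q)) => // /hM.
      move=> h; rewrite -(leq_pmul2l D0) mulnA (mulnC D); apply: leq_trans h _.
      rewrite leq_mul2r (leq_trans cM) ?orbT // /D; lia.
    pose F1 := [set T in F | [exists P in Q, P \subset T]]; pose F0 := F :\: F1.
    have hF T : T \in F -> #|T| = t /\ heavy r K H T.
      by rewrite inE => /and3P[/eqP-> ->].
    have le1 : #|F1| <= #|Q| * n ^ (t - 2).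
      by apply: card_pairs_containing_leq => // [T /hF[]|P /hQ[]].
    have le0 : e' * #|F0| <= n ^ t.-1.
      apply: (@card_heavy_no_heavy_pair n r s l t e' K K2 H F0) => //; try lia.
        by move=> T; rewrite inE => /andP[_ /hF].
      move=> T P; rewrite !inE negb_and => /andP[h hT] sPT c2.
      case/and3P: hT h => cT hT dT; rewrite cT hT dT /= => /existsPn/(_ P).
      rewrite inE sPT c2 eqxx andbT /= negb_and => /orP[// | /negP[]].
      exact: disjointWl sPT dT.
    have eF : #|F| = #|F1| + #|F0|.
      have sF1 : F1 \subset F by apply/subsetP=> T; rewrite inE => /andP[].
      by rewrite -(cardsID F1 F) (setIidPr sF1).
    have et : n ^ t.-1 = n ^ (t - 2) * n by rewrite -expnSr; congr (_ ^ _); lia.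
    have h1 : e' * #|F1| <= n ^ t.-1.
      apply: leq_trans (leq_mul (leqnn e') le1) _.
      by rewrite mulnA et mulnC leq_mul2l leQ orbT.
    have h2 : e' * #|F| <= 2 * n ^ t.-1 by rewrite eF mulnDr mul2n -addnn leq_add.
    rewrite mulnC leq_mul2l; apply/orP; right.
    by rewrite -(leq_pmul2l (isT : 0 < 2)); apply: leq_trans h2; rewrite /e'; lia.
  + have t2 : t = 2 by lia.
    pose D := 48 * K ^ 2 * (2 * l + 1).
    have D0 : 0 < D by rewrite /D muln_gt0 addn_gt0 orbT andbT muln_gt0 expn_gt0 K0.
    exists (e * D), (2 * K * (s + 2) + 16 * K ^ 2 * l + K * s + 1); split.
      by rewrite muln_gt0 e0 D0.
    move=> n Nn H uH np B; rewrite t2; set F := [set T | _].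
    have leF := @card_heavy_pairs_off_leq n r s l (e * D) K H B uH r2 rls np.
    have {leF} := leF _ _ _ (hB n _ H); rewrite -/F => leF.
    exists (cover F); split.
      move=> w /bigcupP[T]; rewrite inE => /and3P[c2 hT dT] wT; split.
        by apply/negP=> wB; move/disjointFr: dT => /(_ w wT); rewrite wB.
      have rT : rich s H T by apply: heavy_rich hT => //; rewrite ?(eqP c2); lia.
      case/cards2P: c2 => u [v [uv eT]].
      have nB z : z \in T -> z \notin B.
        by move=> zT; apply/negP=> zB; move/disjointFr: dT => /(_ z zT); rewrite zB.
      move: wT; rewrite eT !inE => /orP[]/eqP->.
        by exists v; rewrite ?nB ?eT ?inE ?eqxx ?orbT // eq_sym uv -eT.
      by exists u; rewrite ?nB ?eT ?inE ?eqxx ?orbT // uv setUC -eT.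
    rewrite /= (_ : 1`! = 1) // muln1 expn1 leq_mul2r; apply/orP; right.
    rewrite -(leq_pmul2l D0); apply: leq_trans (_ : e * D * (2 * #|F|) <= _).
      by rewrite (mulnC e) -[X in _ <= X]mulnA leq_mul2l (mulnCA e) mulnA leqnn orbT.
    apply: leq_trans (leF _ _ _) _; rewrite -/D; try lia.
    by rewrite (mulnC e D) -mulnA -mulnDr.
(* For [t = 1], a heavy vertex has rich degree at least [n / (2 * K)] and so belongs to [B]. *)
- exists (2 * K), (2 * K * s + 1); split; first by rewrite muln_gt0 K0.
  move=> n Nn H uH np B; exists set0; split=> [w|]; first by rewrite inE.
  rewrite (_ : [set T | _] = set0) ?cards0 ?muln0 //; apply/setP=> T; rewrite !inE.
  apply/negP=> /and3P[/eqP]; rewrite t1 => /eqP/cards1P[v ->] hT.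
  rewrite disjoints_subset sub1set !inE => /negP; apply.
  have := @heavy_extensions n r s K H [set v] uH; rewrite cards1 => /(_ (ltnW r2) hT).
  rewrite (_ : [set w | _] = nbr s H v); last by apply/setP=> w; rewrite !inE setUC.
  lia.
Qed.

(** * Families close to the extremal one *)

Lemma expn_leq_bin (n c k : nat) :
  2 * (c + k) <= n -> n ^ k <= 2 ^ k * k`! * 'C(n - c, k).
Proof.
move=> le; rewrite -mulnA (mulnC k`!) bin_ffact.
have : forall j m, m - j >= n - c - k -> m >= j -> (n - c - k) ^ j <= m ^_ j.
  elim=> [|j IH] [|m] //= h1 h2; rewrite ffactSS expnS leq_mul //; first by lia.
  by apply: IH; lia.
move=> /(_ k (n - c)) h; apply: leq_trans (_ : 2 ^ k * (n - c - k) ^ k <= _).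
  by rewrite -expnMn leq_exp2rW //; lia.
by rewrite leq_mul2l h ?orbT //; lia.
Qed.

Lemma powR_le_linear (R : realType) (p x d : R) :
  (1 < p -> 0 <= x -> x <= d -> x `^ p <= d `^ (p - 1) * x)%R.
Proof.
move=> p1 x0 xd; have p0 : (0 < p)%R by lra.
rewrite -(mulr_powRB1 x0 p0) mulrC ler_wpM2r //.
by apply: ge0_ler_powR => //; rewrite ?nnegrE //; lra.
Qed.

Lemma bernoulli_le (R : realType) (u : R) (P : nat) :
  (0 <= u -> u <= 1 -> 1 - P%:R * (1 - u) <= u ^+ P)%R.
Proof.
move=> u0 u1; elim: P => [|P IH]; first by rewrite expr0; lra.
rewrite exprS; apply: le_trans (ler_wpM2l u0 IH); rewrite -natr1.
have h : (0 <= P%:R * ((1 - u) * (1 - u)))%R.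
  by rewrite mulr_ge0 // ?mulr_ge0 //; lra.
nra.
Qed.

(** A Lipschitz bound without derivatives: with [u = y / x], Bernoulli's inequality for the integer
    [P] gives [1 - u^p <= 1 - u^P <= P * (1 - u)]. *)
Lemma powR_sub_le (R : realType) (p x y d : R) (P : nat) :
  (1 < p -> p <= P%:R -> 0 <= y -> y <= x -> x <= d ->
  x `^ p - y `^ p <= d `^ (p - 1) * P%:R * (x - y))%R.
Proof.
move=> p1 pP y0 yx xd; have x0 : (0 <= x)%R by lra.
have P1 : (1 <= P%:R :> R)%R by lra.
have d0 : (0 <= d `^ (p - 1))%R by exact: powR_ge0.
have h1 := powR_le_linear p1 x0 xd.
have [ey | ny] := eqVneq y 0%R.
  rewrite ey powR0 ?subr0; last by apply/eqP; lra.
  by apply: le_trans h1 _; rewrite -mulrA ler_wpM2l //; nra.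
have yp : (0 < y)%R by rewrite lt_neqAle eq_sym ny.
have xp : (0 < x)%R by lra.
have u0 : (0 < y / x)%R by rewrite divr_gt0.
have u1 : (y / x <= 1)%R by rewrite ler_pdivrMr // mul1r.
have hP : ((y / x) ^+ P <= (y / x) `^ p)%R.
  rewrite -powR_mulrn ?(ltW u0) //; have hu : (0 < y / x <= 1)%R by rewrite u0 u1.
  exact: (ger_powR hu pP).
have hB := bernoulli_le P (ltW u0) u1.
have eyp : (y `^ p = x `^ p * (y / x) `^ p)%R.
  by rewrite -powRM ?divr_ge0 ?ltW // mulrCA divff ?mulr1 // gt_eqF.
have hx : (x `^ p * (1 - y / x) <= d `^ (p - 1) * (x - y))%R.
  have -> : (x - y = x * (1 - y / x))%R.
    by rewrite mulrBr mulr1 mulrCA divff ?mulr1 // gt_eqF.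
  by rewrite mulrA ler_wpM2r // subr_ge0.
have h2 : (x `^ p - y `^ p <= x `^ p * (P%:R * (1 - y / x)))%R.
  by rewrite eyp -[X in (X - _)%R]mulr1 -mulrBr ler_wpM2l ?powR_ge0 //; lra.
apply: le_trans h2 _; rewrite mulrCA mulrAC [X in (_ <= X)%R]mulrC.
by rewrite ler_wpM2l // ler0n.
Qed.

Lemma degree_meeting_family (n r : nat) (A T : {set 'I_n}) :
  #|T| <= r -> ~~ [disjoint T & A] ->
  degree (meeting_family r A) T = 'C(n - #|T|, r - #|T|).
Proof.
move=> cT dT; rewrite -[n in 'C(n - _, _)]card_ord -card_sets_containing //.
apply: eq_card => E; rewrite !inE; case: (#|E| == r) => //=.
case: (boolP (T \subset E)) => sTE; rewrite ?andbF //= andbT setI_eq0.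
by apply: contra dT; apply: disjointWl.
Qed.

Lemma meeting_family_uniform (n r : nat) (A : {set 'I_n}) :
  uniform r (meeting_family r A).
Proof. by move=> E; rewrite inE => /andP[/eqP]. Qed.

(* Every missing edge costs at least [D^(p-1)], while each edge avoiding [A]
   gains at most [P 2^r D^(p-1)], where [D] is the maximum possible degree. *)
Lemma tpnorm_meeting_family_gap (R : realType) (n r t P : nat) (p : R)
    (A : {set 'I_n}) (H : {set {set 'I_n}}) :
  (1 < p)%R -> (p <= P%:R)%R -> 0 < t -> t <= r -> uniform r H ->
  (tpnorm t p H + 'C(n - t, r - t)%:R `^ (p - 1) * #|meeting_family r A :\: H|%:R <=
   tpnorm t p (meeting_family r A) + 'C(n - t, r - t)%:R `^ (p - 1) * (P * (2 ^ r * #|[set E in H | [disjoint E & A]]|))%:R)%R.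
Proof.
move=> p1 pP t0 tr uH; set D : R := ('C(n - t, r - t)%:R)%R; set F := meeting_family r A; set HL := [set E in H | _].
have uHL : uniform r HL by move=> E; rewrite inE => /andP[/uH].
have uF : uniform r F by exact: meeting_family_uniform.
have d0 : (0 <= D `^ (p - 1))%R by exact: powR_ge0.
(* Missing edges are charged only to [t]-sets meeting [A], where the extremal degree is the maximum
   [D]. *)
pose m (T : {set 'I_n}) := ~~ [disjoint T & A] * degree (F :\: H) T.
have key (T : {set 'I_n}) : #|T| == t ->
   ((degree H T)%:R `^ p + D `^ (p - 1) * (m T)%:R <=
    (degree F T)%:R `^ p + D `^ (p - 1) * (P * degree HL T)%:R)%R.
  move=> /eqP cT; rewrite /m; case: (boolP [disjoint T & A]) => dT /=; last first.
    have eD : degree F T = 'C(n - t, r - t) by rewrite -cT degree_meeting_family ?cT.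
    have eM : degree F T = degree H T + degree (F :\: H) T.
      rewrite /degree -(cardsID H [set E in F | T \subset E]); congr (_ + _).
        apply: eq_card => E; rewrite !inE; case: (boolP (E \in H)) => HE; rewrite ?andbF ?andbT //.
        rewrite (uH _ HE) eqxx /=; case: (boolP (T \subset E)) => sTE; rewrite ?andbF // andbT.
        by rewrite setI_eq0; apply: contra dT; apply: disjointWl.
      by apply: eq_card => E; rewrite !inE andbA.
    rewrite mul1n eD -/D.
    have hle : ((degree H T)%:R <= D)%R by rewrite ler_nat -eD eM leq_addr.
    have h1 := powR_le_linear p1 (ler0n _ (degree H T)) hle.
    have h2 : (D `^ p = D `^ (p - 1) * D)%R.
      by rewrite mulrC mulr_powRB1 ?ler0n //; lra.
    have h3 : D = ((degree H T)%:R + (degree (F :\: H) T)%:R)%R by rewrite -natrD -eM eD.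
    have h4 : (0 <= D `^ (p - 1) * (P * degree HL T)%:R)%R by rewrite mulr_ge0.
    have h5 : (D `^ (p - 1) * D = D `^ (p - 1) * (degree H T)%:R
        + D `^ (p - 1) * (degree (F :\: H) T)%:R)%R by rewrite -mulrDr -h3.
    by rewrite h2 h5; lra.
  rewrite mul0n mulr0 addr0.
  have [le | lt] := leqP (degree H T) (degree F T).
    apply: (@le_trans _ _ ((degree F T)%:R `^ p)%R).
      apply: ge0_ler_powR; rewrite ?nnegrE ?ler0n ?ler_nat //; lra.
    by rewrite lerDl mulr_ge0.
  have hL : degree H T <= degree F T + degree HL T.
    rewrite -leq_subLR; apply: leq_trans (_ : #|[set E in H | T \subset E] :\: [set E in F | T \subset E]| <= _).
      by rewrite cardsD leq_sub2l // subset_leq_card // subsetIr.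
    apply/subset_leq_card/subsetP=> E; rewrite !inE => /andP[h /andP[HE sTE]].
    by move: h; rewrite (uH _ HE) HE sTE eqxx /= !andbT negbK setI_eq0.
  have hD : ((degree H T)%:R <= D)%R by rewrite ler_nat -cT degree_leq_bin ?cT.
  have := powR_sub_le p1 pP (ler0n _ (degree F T)) _ hD.
  rewrite ler_nat (ltnW lt) => /(_ isT) h.
  rewrite -lerBlDl; apply: le_trans h _; rewrite natrM -mulrA ler_wpM2l // ler_wpM2l //.
  by rewrite lerBlDl -natrD ler_nat.
have sum_key : (tpnorm t p H + D `^ (p - 1) * (\sum_(T : {set 'I_n} | #|T| == t) m T)%:R <=
   tpnorm t p F + D `^ (p - 1) * (P * \sum_(T : {set 'I_n} | #|T| == t) degree HL T)%:R)%R.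
  rewrite /tpnorm big_distrr /= !natr_sum !mulr_sumr -!big_split /=.
  exact: ler_sum.
have le_lost : #|F :\: H| <= \sum_(T : {set 'I_n} | #|T| == t) m T.
  rewrite -sum1_card /m.
  under [X in _ <= X]eq_bigr do rewrite degree_sum big_distrr /= big_mkcond.
  rewrite exchange_big /= big_mkcond; apply: leq_sum => E _.
  case: ifP => // EFH.
  have [v /andP[/= vE vA]] : exists v, (v \in E) && (v \in A).
    apply/existsP; move: EFH; rewrite !inE => /and3P[_ _ /set0Pn[v]].
    by rewrite inE => vEA; apply/existsP; exists v.
  have cE : #|E| = r by move: EFH; rewrite !inE => /and3P[_ /eqP].
  have : 0 < #|[set T : {set 'I_n} | [&& #|T| == t, [set v] \subset T & T \subset E]]|.
    rewrite card_sets_between ?sub1set ?cards1 // cE bin_gt0; lia.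
  case/card_gt0P=> T; rewrite inE sub1set => /and3P[cT vT sTE].
  rewrite (bigD1 T) //= sTE muln1; apply: leq_trans (leq_addr _ _).
  by rewrite lt0b; apply/pred0Pn; exists v; rewrite /= vT.
apply: (@le_trans _ _ (tpnorm t p H + D `^ (p - 1) * (\sum_(T : {set 'I_n} | #|T| == t) m T)%:R)%R).
  by rewrite lerD2l ler_wpM2l // ler_nat.
apply: le_trans sum_key _; rewrite lerD2l ler_wpM2l // ler_nat.
by rewrite leq_mul2l (sum_degree _ uHL) leq_mul2r bin_leq_exp2 !orbT.
Qed.

(* A vertex [x] of an edge avoiding [A] is in no rich pair with [A], since the
   path could otherwise start with that edge; hence most edges through [x] and
   [A] are missing. *)
Lemma off_edges_few (n r s a g P : nat) (A : {set 'I_n}) (H : {set {set 'I_n}}) :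
  uniform r H -> 2 < r -> 0 < a -> #|A| = a -> r * (2 * a + 1) <= s ->
  ~ has_path (2 * a + 1) H ->
  (forall v, v \in A -> g * (n - #|nbr s H v|) <= n) -> 2 * a <= g ->
  P * 2 ^ r * (r * (2 * a + 1) * (2 * (2 ^ (r - 2) * (r - 2)`!) * r)) < g ->
  2 * (2 ^ (r - 2) * (r - 2)`!) * s + 2 * (r + a) <= n ->
  [set E in H | [disjoint E & A]] = set0 \/
  P * (2 ^ r * #|[set E in H | [disjoint E & A]]|) < #|meeting_family r A :\: H|.
Proof.
set l := 2 * a + 1; set c1 := 2 ^ (r - 2) * (r - 2)`!; set HL := [set E in H | _].
move=> uH r2 a0 cA rls np hA ga gP nN; set Miss := meeting_family r A :\: H.
have n0 : 0 < n by lia.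
case: (set_0Vmem HL) => [->|[E0 HLE0]]; [by left | right].
have [v0 v0A] : exists v, v \in A by apply/set0Pn; rewrite -card_gt0 cA.
(* Each vertex of [A] misses at most [n / g] vertices and [2 * a <= g], so at least half of all
   vertices are common neighbours. *)
have cZ : r + a <= #|[set z | [forall v in A, z \in nbr s H v]]|.
  set Z := [set z | _].
  have hZ : #|~: Z| <= \sum_(v in A) #|~: nbr s H v|.
    rewrite -sum1_card; under [X in _ <= X]eq_bigr do rewrite -sum1_card big_mkcond.
    rewrite exchange_big /= big_mkcond; apply: leq_sum => z _; case: ifP => //.
    rewrite !inE negb_forall => /existsP[v]; rewrite negb_imply => /andP[vA zv].
    by rewrite (bigD1 v) //= inE zv.
  have h1 : g * #|~: Z| <= a * n.
    apply: leq_trans (leq_mul (leqnn g) hZ) _; rewrite big_distrr -cA -sum_nat_const /=.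
    by apply: leq_sum => v vA; rewrite cardsCs setCK card_ord; apply: hA.
  have h2 : 2 * #|~: Z| <= n.
    rewrite -(leq_pmul2l a0); apply: leq_trans h1.
    by rewrite mulnA (mulnC a) leq_mul2r ga orbT.
  have h3 : #|Z| + #|~: Z| = n by rewrite cardsC card_ord.
  lia.
pose L := cover HL.
have LP x : x \in L -> x \notin A /\ forall v, v \in A -> x \notin nbr s H v.
  case/bigcupP=> E; rewrite inE => /andP[HE dE] xE; split.
    by apply/negP=> xA; move/disjointFr: dE => /(_ x xE); rewrite xA.
  move=> v vA; apply/negP=> xv; apply: np.
  apply: (@rich_alternating_walk n r s a H E A x v) => //; first by lia.
    exact: rich_edge.
  by rewrite (uH _ HE).
have leL : g * #|L| <= n.
  apply: leq_trans (hA v0 v0A); rewrite leq_mul2l; apply/orP; right.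
  have -> : n - #|nbr s H v0| = #|~: nbr s H v0| by rewrite [RHS]cardsCs setCK card_ord.
  apply/subset_leq_card/subsetP=> x /LP[_ /(_ v0 v0A)]; by rewrite !inE.
have leHL : #|HL| <= r * l * #|L| ^ r.-1.
  apply: (@card_no_path n r l HL L); first by move=> E; rewrite inE => /andP[/uH].
  - by lia.
  - by move=> E HE; apply: bigcup_sup.
  - by case=> S skS SH; apply: np; exists S => // i /SH; rewrite inE => /andP[].
have missx x : x \in L -> n ^ (r - 2) <= 2 * c1 * degree Miss [set v0; x].
  case/LP=> xA /(_ v0 v0A); rewrite inE negb_and negbK => /orP[/eqP e|nr].
    by rewrite e v0A in xA.
  have xv0 : v0 != x by apply: contraNneq xA => <-.
  have c2 : #|[set v0; x]| = 2 by rewrite cards2 xv0.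
  have := degree_not_rich uH _ nr; rewrite c2 => /(_ (ltnW r2)) h1.
  have eM : 'C(n - 2, r - 2) = degree H [set v0; x] + degree Miss [set v0; x].
    have nd : ~~ [disjoint [set v0; x] & A].
      by apply/pred0Pn; exists v0; rewrite /= !inE eqxx.
    rewrite -c2 -(degree_meeting_family _ nd) ?c2 1?ltnW // /degree.
    rewrite -(cardsID H [set E in meeting_family r A | _]); congr (_ + _); apply: eq_card => E.
      rewrite !inE; case: (boolP (E \in H)) => HE; rewrite ?andbF ?andbT //.
      rewrite (uH _ HE) eqxx /=; case: (boolP (_ \subset E)) => sE; rewrite ?andbF // andbT.
      by apply/set0Pn; exists v0; rewrite inE v0A (subsetP sE) // !inE eqxx.
    by rewrite !inE andbA.
  have h2 : n ^ (r - 2) <= c1 * 'C(n - 2, r - 2) by apply: expn_leq_bin; lia.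
  have h3 : 2 * c1 * s * n ^ (r - 2) <= n * n ^ (r - 2) by rewrite leq_mul2r; apply/orP; right; lia.
  rewrite -(leq_pmul2l n0); move: h1 h2 h3; rewrite eM.
  move: (degree H _) (degree Miss _) (n ^ (r - 2)) => dH dM N; clearbody c1; nia.
have sumM : \sum_(x in L) degree Miss [set v0; x] <= r * #|Miss|.
  under eq_bigr do rewrite degree_sum.
  rewrite exchange_big /= mulnC -sum_nat_const; apply: leq_sum => E.
  rewrite !inE => /and3P[_ /eqP cE _]; rewrite -cE -sum1_card big_mkcond [X in _ <= X]big_mkcond /=.
  apply: leq_sum => x _; rewrite subUset !sub1set; case: (x \in L) => //.
  by case: (x \in E); rewrite ?andbF ?andbT // leq_b1.
have leM : #|L| * n ^ (r - 2) <= 2 * c1 * r * #|Miss|.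
  apply: leq_trans (_ : \sum_(x in L) 2 * c1 * degree Miss [set v0; x] <= _).
    by rewrite -sum_nat_const; apply: leq_sum => x /missx.
  by rewrite -big_distrr -[X in _ <= X]mulnA leq_mul2l sumM orbT.
have leg : g * #|HL| <= r * l * (2 * c1 * r) * #|Miss|.
  apply: leq_trans (leq_mul (leqnn g) leHL) _; rewrite mulnCA -[X in _ <= X]mulnA leq_mul2l.
  apply/orP; right; apply: leq_trans leM.
  (* In [g * #|L|^(r-1)] one factor [#|L|] is kept, one absorbs [g] through [g * #|L| <= n], and the
     other [r - 3] are bounded by [n]. *)
  have -> : r.-1 = (r - 3).+2 by lia.
  have -> : r - 2 = (r - 3).+1 by lia.
  rewrite !expnS mulnCA leq_mul2l mulnA leq_mul ?orbT //.
  apply: leq_exp2rW; rewrite -[X in _ <= X]card_ord; exact: max_card.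
have HL0 : 0 < #|HL| by apply/card_gt0P; exists E0.
have : P * 2 ^ r * (r * l * (2 * c1 * r)) * #|HL| < g * #|HL| by rewrite ltn_pmul2r.
move=> /leq_trans/(_ leg); rewrite mulnAC (mulnC (r * l * _)) ltn_mul2r => /andP[_].
by rewrite -mulnA.
Qed.

Lemma near_extremal (R : realType) (n r t s a g P : nat) (p : R)
    (A : {set 'I_n}) (H : {set {set 'I_n}}) :
  (1 < p)%R -> (p <= P%:R)%R -> 0 < t -> t < r ->
  uniform r H -> 2 < r -> 0 < a -> #|A| = a -> r * (2 * a + 1) <= s ->
  ~ has_path (2 * a + 1) H ->
  (forall v, v \in A -> g * (n - #|nbr s H v|) <= n) -> 2 * a <= g ->
  P * 2 ^ r * (r * (2 * a + 1) * (2 * (2 ^ (r - 2) * (r - 2)`!) * r)) < g ->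
  2 * (2 ^ (r - 2) * (r - 2)`!) * s + 2 * (r + a) <= n ->
  H = meeting_family r A \/ (tpnorm t p H < tpnorm t p (meeting_family r A))%R.
Proof.
move=> p1 pP t0 tr uH r2 a0 cA rls np hA ga gP nN.
have gap := tpnorm_meeting_family_gap A p1 pP t0 (ltnW tr) uH.
have D0 : (0 < ('C(n - t, r - t)%:R : R) `^ (p - 1))%R.
  by rewrite powR_gt0 // ltr0n bin_gt0; lia.
have [e|lt] := off_edges_few uH r2 a0 cA rls np hA ga gP nN; last first.
  right; move: gap lt; set x := #|_ :\: _|; set y := P * _ => gap lt.
  have : ('C(n - t, r - t)%:R `^ (p - 1) * y%:R < 'C(n - t, r - t)%:R `^ (p - 1) * x%:R :> R)%R.
    by rewrite ltr_pM2l // ltr_nat.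
  by move: gap; lra.
have sHF : H \subset meeting_family r A.
  apply/subsetP=> E HE; rewrite inE (uH _ HE) eqxx /= setI_eq0.
  by apply/negP=> dE; have := in_set0 E; rewrite -e inE HE dE.
case: (set_0Vmem (meeting_family r A :\: H)) => [/eqP|[E0 E0M]].
  by rewrite setD_eq0 => sFH; left; apply/eqP; rewrite eqEsubset sHF.
right; move: gap; rewrite e cards0 !muln0 mulr0 addr0; apply: lt_le_trans.
rewrite ltrDl mulr_gt0 // ltr0n; apply/card_gt0P; by exists E0.
Qed.

(** * Stability *)

(* Convexity: [sum x] is at most about [a n] while [sum x^2] is at least about
   [a n^2], so [sum x (n - x)] is small and each [x v] is close to [0] or [n]. *)
Lemma near_full_vertices (n a e g u C1 C2 C3 : nat) (B : {set 'I_n})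
    (x : 'I_n -> nat) :
  0 < n -> 0 < g -> (forall v, x v <= n) ->
  (C3 + 4) * (2 * a + 3 + 2 * g) < e -> e * C1 <= n -> e * C2 <= n ->
  \sum_(v in B) x v + u <= a * n + C1 ->
  2 * e * a * n ^ 2 <= 2 * e * \sum_(v in B) x v ^ 2 + e * u * n +
                       (1 + C3) * n ^ 2 + e * C2 * n ->
  exists A : {set 'I_n}, #|A| = a /\ forall v, v \in A -> g * (n - x v) <= n.
Proof.
move=> n0 g0 xn; set C4 := C3 + 4 => he n1 n2 h1 h2.
have e0 : 0 < e by lia.
pose s1 := \sum_(v in B) x v; pose s2 := \sum_(v in B) x v ^ 2.
pose s3 := \sum_(v in B) x v * (n - x v).
have es : s3 + s2 = n * s1.
  rewrite /s3 /s2 /s1 -big_split big_distrr /=; apply: eq_bigr => v _.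
  by rewrite -mulnn -mulnDr subnK // mulnC.
(* [u] has weight [2 * e] in the first hypothesis and [e] in the second, so a surplus stays on the
   left: the matching never pays. The three units of [C4] beyond [1 + C3] absorb the terms in [C1]
   and [C2]. *)
have hs : e * (2 * s3) + e * u * n <= C4 * n ^ 2.
  have k1 : e * C1 * n <= n * n by rewrite leq_mul2r n1 orbT.
  have k2 : e * C2 * n <= n * n by rewrite leq_mul2r n2 orbT.
  have k3 : 2 * e * n * (s1 + u) <= 2 * e * n * (a * n + C1) by rewrite leq_mul2l h1 orbT.
  have k4 : 2 * e * (s3 + s2) = 2 * e * (n * s1) by rewrite es.
  move: h2 k1 k2 k3 k4; rewrite -/s2 /C4 -mulnn; clearbody s1 s2 s3; lia.
have hv v : v \in B -> e * (x v * (n - x v)) <= C4 * n ^ 2.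
  move=> vB; apply: leq_trans hs; apply: leq_trans (leq_addr _ _).
  rewrite leq_mul2l /s3 (bigD1 v) //=; apply/orP; right.
  by rewrite mul2n -addnn -!addnA leq_addr.
pose Lg := [set v in B | n <= 2 * x v].
have hLg v : v \in Lg -> e * (n - x v) <= 2 * C4 * n.
  rewrite inE => /andP[/hv h xv]; rewrite -(leq_pmul2l n0).
  have : e * (n * (n - x v)) <= e * (2 * x v * (n - x v)) by rewrite leq_mul2l leq_mul2r xv !orbT.
  rewrite -mulnn in h; move: (n - x v) (x v) h => y z; nia.
(* A vertex below [n / 2] even satisfies [e * x v <= 2 * C4 * n]. *)
have hsm : e * \sum_(v in B :\: Lg) x v ^ 2 <= 2 * C4 * n * s1.
  rewrite !big_distrr /= big_mkcond [X in _ <= X]big_mkcond; apply: leq_sum => v _.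
  rewrite !inE; case: (boolP (v \in B)) => vB; rewrite ?andbF //= andbT -ltnNge.
  case: ltnP => // xv; rewrite -mulnn mulnA leq_mul2r; apply/orP; right.
  have h := hv v vB; rewrite -(leq_pmul2l n0); rewrite -mulnn in h.
  have : e * x v * n <= e * x v * (2 * (n - x v)) by rewrite leq_mul2l; apply/orP; right; lia.
  move: (n - x v) (x v) h => y z; nia.
have hs1 : s1 <= a.+1 * n by rewrite mulSn; move: h1; rewrite -/s1; nia.
have hlg : \sum_(v in Lg) x v ^ 2 <= #|Lg| * n ^ 2.
  by rewrite -sum_nat_const; apply: leq_sum => v _; apply: leq_exp2rW.
have e2 : s2 = \sum_(v in Lg) x v ^ 2 + \sum_(v in B :\: Lg) x v ^ 2.
  rewrite /s2 (big_setID Lg) /=; congr (_ + _); apply: eq_bigl => v.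
  by rewrite !inE; case: (v \in B).
(* With fewer than [a] large vertices the sum of squares would fall short of [a * n ^ 2] by nearly
   [n ^ 2]. *)
have aLg : a <= #|Lg|.
  rewrite leqNgt; apply/negP=> ltL.
  have k1 : 2 * e * (#|Lg|.+1 * n ^ 2) <= 2 * e * (a * n ^ 2) by rewrite leq_mul2l leq_mul2r ltL !orbT.
  have k2 : e * C2 * n <= n ^ 2 by rewrite -mulnn leq_mul2r n2 orbT.
  have k3 : 2 * C4 * n * s1 <= 2 * C4 * n * (a.+1 * n) by rewrite leq_mul2l hs1 orbT.
  have k4 : 2 * e * \sum_(v in Lg) x v ^ 2 <= 2 * e * (#|Lg| * n ^ 2) by rewrite leq_mul2l hlg orbT.
  have k5 : C4 * (2 * a + 3 + 2 * g) * n ^ 2 < e * n ^ 2 by rewrite ltn_pmul2r // expn_gt0 n0.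
  move: h2 hs hsm; rewrite -/s2 e2.
  have k6 : n * n = n ^ 2 by rewrite mulnn.
  have k7 : 2 * C4 * n * (a.+1 * n) = 2 * C4 * a.+1 * n ^ 2 by rewrite -k6; lia.
  rewrite k7 in k3.
  move: k1 k2 k3 k4 k5; rewrite /C4.
  move: (\sum_(v in Lg) _) (\sum_(v in B :\: Lg) _) (n ^ 2) (2 * _ * n * s1) => y1 y2 N z.
  clear; move: (e * u * n) (e * C2 * n) #|Lg| (s3) => w1 w2 L t3.
  lia.
have [A sA cA] := exists_subset_card aLg; exists A; split=> // v /(subsetP sA)/hLg h.
have C40 : 0 < 2 * C4 by rewrite /C4; lia.
rewrite -(leq_pmul2l C40); apply: leq_trans h; rewrite mulnA leq_mul2r; apply/orP; right.
by rewrite /C4 in he *; nia.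
Qed.

Lemma expn_leq_subn (n c k : nat) : n ^ k <= (n - c) ^ k + k * c * n ^ k.-1.
Proof.
elim: k => [|k IH] //=.
case: k IH => [_ | k IH]; first by rewrite !expn1 expn0; lia.
have h1 : n * n ^ k.+1 <= n * ((n - c) ^ k.+1 + k.+1 * c * n ^ k) by rewrite leq_mul2l IH orbT.
have h2 : (n - c) ^ k.+1 <= n ^ k.+1 by rewrite leq_exp2rW // leq_subr.
have h3 : n * (n - c) ^ k.+1 <= (n - c) * (n - c) ^ k.+1 + c * n ^ k.+1.
  have : n * (n - c) ^ k.+1 <= (n - c + c) * (n - c) ^ k.+1 by rewrite leq_mul2r; apply/orP; right; lia.
  by rewrite mulnDl => /leq_trans; apply; rewrite leq_add2l leq_mul2l h2 orbT.
rewrite expnS [(n - c) ^ k.+2]expnS.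
have e1 : n * (k.+1 * c * n ^ k) = k.+1 * c * n ^ k.+1 by rewrite expnS mulnCA.
move: h1 h3; rewrite mulnDr e1; move: (n * (n - c) ^ k.+1) ((n - c) * _) (n * n ^ k.+1) => *.
rewrite -[k.+2]addn1 mulnDl mul1n mulnDl; lia.
Qed.

Lemma ffact_geq (m k : nat) : (m - k) ^ k <= m ^_ k.
Proof.
elim: k m => [|k IH] [|m] //; first by rewrite sub0n exp0n.
rewrite ffactSS expnS leq_mul //; first by rewrite leq_subLR; lia.
by apply: leq_trans (IH m); rewrite leq_exp2rW //; lia.
Qed.

Lemma ffact_leq (m k : nat) : m ^_ k <= m ^ k.
Proof.
elim: k m => [|k IH] [|m] //; rewrite ffactSS expnS leq_mul2l.
by rewrite (leq_trans (IH m)) ?orbT // leq_exp2rW.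
Qed.

(** Only the [t]-sets meeting [A] in exactly one vertex are counted; the others are of lower
    order. *)
Lemma tpnorm_meeting_family_geq (R : realType) (n r t : nat) (p : R)
    (A : {set 'I_n}) :
  (1 < p)%R -> 0 < t -> t <= r ->
  ('C(n - t, r - t)%:R `^ (p - 1) *
     (#|A| * 'C(n - #|A|, t.-1) * 'C(n - t, r - t))%:R
   <= tpnorm t p (meeting_family r A))%R.
Proof.
move=> p1 t0 tr; set D : R := ('C(n - t, r - t)%:R)%R.
have count : #|A| * 'C(n - #|A|, t.-1) <=
    \sum_(T : {set 'I_n} | #|T| == t) ~~ [disjoint T & A].
  apply: leq_trans (_ : \sum_(v in A) \sum_(T : {set 'I_n} | #|T| == t) (T :&: A == [set v]) <= _).
    rewrite -sum_nat_const; apply: leq_sum => v vA.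
    have -> : n - #|A| = #|~: A| by rewrite [RHS]cardsCs setCK card_ord.
    rewrite -cards_draws -(@card_in_imset _ _ (fun S => v |: S)); last first.
      move=> S S'; rewrite !inE => /andP[/subsetP sS _] /andP[/subsetP sS' _] e.
      have vS (X : {set 'I_n}) : (forall x, x \in X -> x \in ~: A) -> v \notin X.
        by move=> h; apply/negP=> /h; rewrite inE vA.
      by rewrite -(setU1K (vS _ sS)) -(setU1K (vS _ sS')) e.
    rewrite -sum1_card big_mkcond [X in _ <= X]big_mkcond /=; apply: leq_sum => T _.
    case: ifP => // /imsetP[S]; rewrite inE => /andP[/subsetP sS /eqP cS] ->.
    have vS : v \notin S by apply/negP=> /sS; rewrite inE vA.
    rewrite cardsU1 vS cS add1n prednK // eqxx lt0b; apply/eqP/setP=> x; rewrite !inE.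
    case: (x =P v) => [->|_] //=; apply/negP=> /andP[/sS]; rewrite inE => h1 h2.
    by rewrite h2 in h1.
  rewrite exchange_big /=; apply: leq_sum => T _.
  case: (boolP [disjoint T & A]) => [|_].
    rewrite -setI_eq0 => /eqP->; rewrite big1 // => v vA.
    by case: eqP => // /setP/(_ v); rewrite !inE eqxx.
  case: (boolP [exists v in A, T :&: A == [set v]]) => [/existsP[v /andP[vA /eqP ev]]|].
    rewrite (bigD1 v) //= ev eqxx big1 // => w /andP[_ wv].
    by case: eqP => // /setP/(_ w); rewrite !inE eqxx (negbTE wv).
  by rewrite negb_exists => /forallP h; rewrite big1 // => v vA; have := h v; rewrite vA /=; case: (_ == _).
rewrite natrM mulrCA (mulrC (D `^ _)%R) mulr_powRB1 ?ler0n //; last by lra.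
apply: (@le_trans _ _ ((\sum_(T : {set 'I_n} | #|T| == t) ~~ [disjoint T & A])%:R * D `^ p)%R).
  by rewrite ler_wpM2r ?powR_ge0 // ler_nat.
rewrite natr_sum mulr_suml /tpnorm; apply: ler_sum => T /eqP cT.
case: (boolP [disjoint T & A]) => dT /=; first by rewrite mul0r powR_ge0.
by rewrite mul1r degree_meeting_family ?cT.
Qed.

(** A [t]-set is charged to a vertex of [B] in it, or as heavy off [B] at the maximum degree, or as
    light. A light one of degree [d] satisfies [e * d^p <= (K' * d)^(p-1) * d], which is where
    [p > 1] enters. *)
Lemma tpnorm_heavy_leq (R : realType) (n r t e K K' : nat) (p : R)
    (B : {set 'I_n}) (H : {set {set 'I_n}}) :
  (1 < p)%R -> 0 < t -> t <= r -> uniform r H -> (e%:R <= K'%:R `^ (p - 1))%R ->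
  (forall T : {set 'I_n}, #|T| = t -> ~~ heavy r K H T ->
     K' * degree H T <= 'C(n - t, r - t)) ->
  (e%:R * tpnorm t p H <= 'C(n - t, r - t)%:R `^ (p - 1) *
    (e * ('C(r - 1, t - 1) * (\sum_(v in B) degree H [set v]) +
      'C(n - t, r - t) * #|[set T : {set 'I_n} |
            [&& #|T| == t, heavy r K H T & [disjoint T & B]]]|)
     + 'C(r, t) * #|H|)%:R)%R.
Proof.
move=> p1 t0 tr uH eK light; set F := [set T | _]; set D : R := ('C(n - t, r - t)%:R)%R.
have D0 : (0 <= D `^ (p - 1))%R by exact: powR_ge0.
have key (T : {set 'I_n}) : #|T| == t -> (e%:R * (degree H T)%:R `^ p <=
   D `^ (p - 1) * (e * (\sum_(v in B) (v \in T) * degree H T + 'C(n - t, r - t) * (T \in F))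
                  + degree H T)%:R)%R.
  move=> /eqP cT; have dD : ((degree H T)%:R <= D)%R by rewrite ler_nat -cT degree_leq_bin ?cT.
  have h1 := powR_le_linear p1 (ler0n R (degree H T)) dD.
  have e0 : (0 <= e%:R :> R)%R by [].
  have big m : degree H T <= m -> (e%:R * (degree H T)%:R `^ p <= D `^ (p - 1) * (e * m + degree H T)%:R)%R.
    move=> hm; apply: le_trans (ler_wpM2l e0 h1) _; rewrite mulrCA ler_wpM2l //.
    by rewrite -natrM ler_nat; apply: leq_trans (leq_addr _ _); rewrite leq_mul2l hm orbT.
  case: (boolP [disjoint T & B]) => dT; last first.
    apply: big; apply: leq_trans (leq_addr _ _).
    have /pred0Pn[v /andP[/= vT vB]] := dT.
    by rewrite (bigD1 v) //= vT mul1n leq_addr.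
  case: (boolP (heavy r K H T)) => hT.
    apply: big; rewrite inE cT eqxx hT dT muln1; apply: leq_trans (leq_addl _ _).
    by rewrite -cT degree_leq_bin ?cT.
  have le := light T cT hT.
  apply: (@le_trans _ _ (D `^ (p - 1) * (degree H T)%:R)%R); last first.
    by rewrite ler_wpM2l // ler_nat leq_addl.
  have p0 : (0 < p)%R by lra.
  rewrite -(mulr_powRB1 (ler0n R (degree H T)) p0) mulrCA mulrC ler_wpM2r //.
  apply: (@le_trans _ _ ((K' * degree H T)%:R `^ (p - 1))%R).
    by rewrite natrM powRM ?ler0n // ler_wpM2r ?powR_ge0.
  by apply: ge0_ler_powR; rewrite ?nnegrE ?ler0n ?ler_nat //; lra.
have eB : \sum_(T : {set 'I_n} | #|T| == t) \sum_(v in B) (v \in T) * degree H T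
   = 'C(r - 1, t - 1) * \sum_(v in B) degree H [set v].
  rewrite exchange_big big_distrr /=; apply: eq_bigr => v _.
  have := @sum_degree_containing n r t H [set v] uH; rewrite cards1 => /(_ t0) <-.
  rewrite big_mkcond [RHS]big_mkcond /=; apply: eq_bigr => T _; rewrite sub1set.
  by case: (#|T| == t); case: (v \in T); rewrite ?mul1n.
have eF : \sum_(T : {set 'I_n} | #|T| == t) 'C(n - t, r - t) * (T \in F) = 'C(n - t, r - t) * #|F|.
  rewrite -big_distrr /=; congr (_ * _); rewrite -sum1_card big_mkcond [RHS]big_mkcond /=.
  by apply: eq_bigr => T _; rewrite inE; case: (#|T| == t) => //=; case: (_ && _).
rewrite -eB -eF -(sum_degree _ uH) -big_split /= [(e * \sum_(T | _) _)%N]big_distrr /= -big_split /= natr_sum.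
by rewrite /tpnorm !mulr_sumr; exact: ler_sum.
Qed.

Lemma exists_powR_geq (R : realType) (p : R) (e : nat) :
  (1 < p)%R -> exists2 k : nat, 0 < k & (e%:R <= k%:R `^ (p - 1))%R.
Proof.
move=> p1; have q0 : (0 < p - 1)%R by lra.
have [k hk] : exists k : nat, (e%:R `^ (p - 1)^-1 <= k%:R :> R)%R.
  exists (Num.bound (e%:R `^ (p - 1)^-1 : R)).
  by apply/ltW/archi_boundP; exact: powR_ge0.
exists k.+1 => //; have ek : (e%:R = (e%:R `^ (p - 1)^-1) `^ (p - 1) :> R)%R.
  by rewrite -powRrM mulVf ?gt_eqF // powRr1 // ler0n.
rewrite ek; apply: ge0_ler_powR; rewrite ?nnegrE ?powR_ge0 ?ler0n ?ltW //.
by apply: le_lt_trans hk _; rewrite ltr_nat.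
Qed.

(** Here [f] stands for [(t-1)! * (r-t)!], [N3] for [n^(r-3)], [S2] for the sum of squared rich
    degrees over [B] and [u] for [#|V1|]; [Y], [Z], [W] are the charges to [B], to heavy sets off
    [B] and to light sets. *)
Lemma combine_estimates (n N3 e a f X Y Z W S2 u k1 k2 C3 : nat) :
  0 < n -> 0 < N3 ->
  e * (a * X) <= e * (Y + Z) + W ->
  n ^ 2 * N3 <= f * X + k1 * n * N3 ->
  f * Y <= N3 * S2 + k2 * n * N3 ->
  2 * f * Z * n * e <= (e * u + n) * n ^ 2 * N3 ->
  2 * f * W <= C3 * n ^ 2 * N3 ->
  2 * e * a * n ^ 2 <= 2 * e * S2 + e * u * n + (1 + C3) * n ^ 2
                       + e * (2 * a * k1 + 2 * k2) * n.
Proof.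
move=> n0 N0 h0 h1 h2 h3 h4; have nN : 0 < n * N3 by rewrite muln_gt0 n0.
have e0 := leq_mul (leqnn (2 * f * n)) h0.
have e1 := leq_mul (leqnn (2 * e * a * n)) h1.
have e2 := leq_mul (leqnn (2 * e * n)) h2.
have e4 := leq_mul (leqnn n) h4.
rewrite -(leq_pmul2r nN); move: e0 e1 e2 h3 e4; rewrite -mulnn; clear; lia.
Qed.

Lemma fact_mul_bin_pred (r t : nat) :
  0 < t -> t <= r -> (t.-1)`! * (r - t)`! * 'C(r - 1, t - 1) = (r.-1)`!.
Proof.
move=> t0 tr; rewrite mulnC -!subn1 -(@bin_fact (r - 1) (t - 1)).
  by rewrite (_ : r - 1 - (t - 1) = r - t) //; lia.
by rewrite leq_sub2r.
Qed.

Lemma star_count_geq (n r a t : nat) :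
  0 < t -> t <= r ->
  n ^ r.-1 <= (t.-1)`! * (r - t)`! * ('C(n - a, t.-1) * 'C(n - t, r - t))
              + r.-1 * (a + r) * n ^ (r - 2).
Proof.
move=> t0 tr; apply: leq_trans (expn_leq_subn n (a + r) r.-1) _.
apply: leq_add; last by rewrite (_ : r.-2 = r - 2) //; lia.
rewrite mulnACA (mulnC (t.-1)`!) (mulnC (r - t)`!) !bin_ffact.
rewrite (_ : r.-1 = t.-1 + (r - t)); last by lia.
rewrite expnD leq_mul //; apply: leq_trans (ffact_geq _ _); rewrite leq_exp2rW //; lia.
Qed.

(** With [x] a rich degree, [x^(r-1) <= n^(r-3) * x^2] reduces every [r] to the same quadratic
    convexity argument. *)
Lemma fact_sum_degree_leq (n r s b : nat) (H : {set {set 'I_n}}) (B : {set 'I_n}) :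
  uniform r H -> 2 < r -> #|B| <= b ->
  (r.-1)`! * (\sum_(v in B) degree H [set v]) <=
    n ^ (r - 3) * (\sum_(v in B) #|nbr s H v| ^ 2) + b * ((r.-1)`! * s) * n ^ (r - 2).
Proof.
move=> uH r2 cB; rewrite !big_distrr /=.
apply: leq_trans (_ : \sum_(v in B) (n ^ (r - 3) * #|nbr s H v| ^ 2 + (r.-1)`! * s * n ^ (r - 2)) <= _).
  apply: leq_sum => v _.
  apply: leq_trans (leq_mul (leqnn _) (degree_nbr_leq s v uH (ltnW r2))) _.
  rewrite mulnDr mulnA leq_add2r mulnC bin_ffact; apply: leq_trans (ffact_leq _ _) _.
  rewrite (_ : r.-1 = (r - 3) + 2); last by lia.
  by rewrite expnD leq_mul // leq_exp2rW // -[X in _ <= X]card_ord; exact: max_card.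
by rewrite big_split leq_add2l sum_nat_const /= -[X in _ <= X]mulnA leq_mul.
Qed.

Lemma heavy_count_leq (n r t e u F : nat) :
  0 < t -> t <= r -> 2 * (t.-1)`! * e * F * n <= (e * u + n) * n ^ t.-1 ->
  2 * ((t.-1)`! * (r - t)`!) * ('C(n - t, r - t) * F) * n * e <= (e * u + n) * n ^ r.-1.
Proof.
move=> t0 tr h; have k : (r - t)`! * 'C(n - t, r - t) <= n ^ (r - t).
  rewrite mulnC bin_ffact; apply: leq_trans (ffact_leq _ _) _.
  by rewrite leq_exp2rW // leq_subr.
have := leq_mul h k; rewrite -[X in _ <= X]mulnA -expnD.
rewrite (_ : t.-1 + (r - t) = r.-1); last by lia.
apply: leq_trans; move: (t.-1)`! (r - t)`! 'C(_, _) => x y z; clear; lia.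
Qed.

Lemma stability (R : realType) (r a t g : nat) (p : R) (s := r * (2 * a + 1)) :
  2 < r -> 0 < a -> 0 < t -> t < r -> (1 < p)%R -> 0 < g ->
  exists N, forall n, N <= n -> forall (A : {set 'I_n}) (H : {set {set 'I_n}}),
    #|A| = a -> uniform r H -> ~ has_path (2 * a + 1) H ->
    (tpnorm t p (meeting_family r A) <= tpnorm t p H)%R ->
    exists A' : {set 'I_n},
      #|A'| = a /\ forall v, v \in A' -> g * (n - #|nbr s H v|) <= n.
Proof.
move=> r2 a0 t0 tr p1 g0; pose l := 2 * a + 1.
have l0 : 0 < l by rewrite /l addn1.
pose f := (t.-1)`! * (r - t)`!; pose C3 := 2 * f * (2 ^ r * (r * l)).
(* [e] is fixed before [K'], [K], [q] and [b0], so it cannot depend on the size of [B]; the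
   constants [C1] and [C2] that do are absorbed by taking [n] large. *)
pose e := (C3 + 4) * (2 * a + 3 + 2 * g) + 1.
have e0 : 0 < e by rewrite /e addn1.
have [K' K'0 hK'] := exists_powR_geq e p1.
(* [c] compares [n^(r-t)] with the maximum degree, so a set that is not heavy has at most [1 / K']
   of that maximum. *)
pose c := 2 ^ (r - t) * (r - t)`!; pose K := c * K'.
have c0 : 0 < c by rewrite muln_gt0 expn_gt0 fact_gt0.
have K0 : 0 < K by rewrite muln_gt0 c0.
have [q [N1 [q0 hN1]]] := card_heavy_off_leq r2 t0 tr l0 (leqnn s) e0 K0.
pose b0 := q * (2 * l).
pose C1 := b0.+1 * ((r + a) * 2 ^ b0) + b0 * b0.
pose k1 := r.-1 * (a + r); pose k2 := b0 * ((r.-1)`! * s).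
pose C2 := 2 * a * k1 + 2 * k2.
exists (N1 + 2 * r + e * C1 + e * C2 + 1) => n nN A H cA uH np hH.
have n0 : 0 < n by lia.
set B := [set v | n <= q * #|nbr s H v|].
have [|V1 [hV1 hF]] := hN1 n _ H uH np; first by lia.
rewrite -/B in hV1 hF; set F := [set T | _] in hF.
have cB : #|B| <= b0.
  by apply: card_big_leq => //; apply: (sum_nbr_leq uH) => //; lia.
have hsum : \sum_(v in B) #|nbr s H v| + #|V1| <= a * n + C1.
  apply: leq_trans (sum_nbr_big_leq uH _ a0 (leqnn _) np hV1) _; first by lia.
  rewrite leq_add2l leq_add ?leq_mul // leq_pexp2l //.
have light (T : {set 'I_n}) : #|T| = t -> ~~ heavy r K H T ->
    K' * degree H T <= 'C(n - t, r - t).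
  move=> cT; rewrite /heavy cT -ltnNge => /ltnW h.
  rewrite -(leq_pmul2l c0) mulnA; apply: leq_trans h _; apply: expn_leq_bin; lia.
have hup := tpnorm_heavy_leq B p1 t0 (ltnW tr) uH hK' light.
have hlow := tpnorm_meeting_family_geq A p1 t0 (ltnW tr).
have D0 : (0 < ('C(n - t, r - t)%:R : R) `^ (p - 1))%R.
  by rewrite powR_gt0 // ltr0n bin_gt0; lia.
have h0 : e * (a * ('C(n - a, t.-1) * 'C(n - t, r - t))) <=
    e * ('C(r - 1, t - 1) * (\sum_(v in B) degree H [set v]) + 'C(n - t, r - t) * #|F|)
    + 'C(r, t) * #|H|.
  rewrite -(ler_nat R) -(ler_pM2l D0); apply: le_trans hup.
  rewrite natrM mulrCA; apply: ler_wpM2l; first exact: ler0n.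
  by apply: le_trans hH; apply: le_trans hlow; rewrite cA mulnA.
have en1 : n ^ r.-1 = n ^ 2 * n ^ (r - 3) by rewrite -expnD; congr (_ ^ _); nat_lia.
have en2 : n ^ (r - 2) = n * n ^ (r - 3) by rewrite -expnS; congr (_ ^ _); nat_lia.
have h1 : n ^ 2 * n ^ (r - 3) <= f * ('C(n - a, t.-1) * 'C(n - t, r - t)) + k1 * n * n ^ (r - 3).
  by rewrite -en1 -[k1 * n * _]mulnA -en2; exact: star_count_geq t0 (ltnW tr).
have h2 : f * ('C(r - 1, t - 1) * (\sum_(v in B) degree H [set v])) <=
    n ^ (r - 3) * (\sum_(v in B) #|nbr s H v| ^ 2) + k2 * n * n ^ (r - 3).
  rewrite mulnA (fact_mul_bin_pred t0 (ltnW tr)) -[k2 * n * _]mulnA -en2.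
  exact: fact_sum_degree_leq uH r2 cB.
have h3 : 2 * f * ('C(n - t, r - t) * #|F|) * n * e <= (e * #|V1| + n) * n ^ 2 * n ^ (r - 3).
  by rewrite -[X in _ <= X]mulnA -en1; exact: heavy_count_leq t0 (ltnW tr) hF.
have h4 : 2 * f * ('C(r, t) * #|H|) <= C3 * n ^ 2 * n ^ (r - 3).
  rewrite -[X in _ <= X]mulnA -en1 /C3 -[X in _ <= X]mulnA leq_mul // -[X in _ <= X]mulnA leq_mul ?bin_leq_exp2 //.
  have := @card_no_path n r l H setT uH (ltnW r2) (fun E _ => subsetT E) np.
  by rewrite cardsT card_ord.
have nN3 : 0 < n ^ (r - 3) by rewrite expn_gt0 n0.
have := combine_estimates n0 nN3 h0 h1 h2 h3 h4; rewrite -/C2 => hmain.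
have he : (C3 + 4) * (2 * a + 3 + 2 * g) < e by rewrite /e addn1.
have [|||A' [cA' hA']] := near_full_vertices n0 g0 _ he _ _ hsum hmain.
- by move=> v; rewrite -[X in _ <= X]card_ord; exact: max_card.
- by move: nN; move: (e * C1) (e * C2) => x y nN; nat_lia.
- by move: nN; move: (e * C1) (e * C2) => x y nN; nat_lia.
by exists A'.
Qed.

(** * Invariance under permutations *)

Lemma exists_perm_imset (V : finType) (A B : {set V}) :
  #|A| = #|B| -> exists s : {perm V}, s @: A = B.
Proof.
move=> cAB; pose e (X : {set V}) := enum X ++ enum (~: X).
have ue X : uniq (e X).
  rewrite cat_uniq !enum_uniq andbT /=; apply/hasPn=> x.
  by rewrite !mem_enum inE.
have me X x : x \in e X by rewrite mem_cat !mem_enum inE orbN.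
have se X : size (e X) = #|V| by rewrite size_cat -!cardE cardsC.
pose f x := nth x (e B) (index x (e A)).
have fi x : index x (e A) < size (e B) by rewrite se -(se A) index_mem.
have f_inj : injective f.
  move=> x y; rewrite /f (set_nth_default y) // => /eqP.
  rewrite nth_uniq // => /eqP h.
  by rewrite -(nth_index x (me A x)) h (set_nth_default y) ?index_mem // nth_index.
exists (perm f_inj); apply/eqP; rewrite eqEcard (card_imset _ perm_inj) cAB leqnn andbT.
apply/subsetP=> _ /imsetP[x xA ->]; rewrite permE /f nth_cat index_cat mem_enum xA.
have h : index x (enum A) < size (enum B) by rewrite -cardE -cAB cardE index_mem mem_enum.
by rewrite h -mem_enum mem_nth.
Qed.

Lemma meeting_family_perm (n r : nat) (A : {set 'I_n}) (s : {perm 'I_n}) :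
  [set s @: (E : {set 'I_n}) | E in meeting_family r A]
    = meeting_family r (s @: A).
Proof.
apply/setP=> E; apply/imsetP/idP.
  case=> F; rewrite !inE => /andP[cF FA] ->; rewrite (card_imset _ perm_inj) cF /=.
  rewrite -imsetI; last by move=> x y _ _; exact: perm_inj.
  by case/set0Pn: FA => x xFA; apply/set0Pn; exists (s x); apply: imset_f.
rewrite inE => /andP[cE /set0Pn[y]]; rewrite inE => /andP[yE /imsetP[x xA ey]].
have eE : E = s @: (s^-1%g @: E).
  rewrite -imset_comp -[LHS]imset_id; apply: eq_imset => z /=.
  by rewrite permKV.
exists (s^-1%g @: E) => //; rewrite inE (card_imset _ perm_inj) cE /=.
by apply/set0Pn; exists x; rewrite inE xA andbT -(permK s x) -ey imset_f.
Qed.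

Lemma tpnorm_perm (R : realType) (n t : nat) (p : R) (H : {set {set 'I_n}})
    (s : {perm 'I_n}) :
  tpnorm t p [set s @: (E : {set 'I_n}) | E in H] = tpnorm t p H.
Proof.
have sI : injective (fun E : {set 'I_n} => s @: E) by exact: imset_inj perm_inj.
rewrite /tpnorm (reindex_inj sI) /=; apply: eq_big => [T | T _].
  by rewrite (card_imset _ perm_inj).
congr (_%:R `^ p)%R; rewrite /degree -(card_imset [set E in H | T \subset E] sI).
apply: eq_card => E; rewrite !inE; apply/andP/imsetP.
  case=> /imsetP[F HF ->] sTF; exists F => //; rewrite inE HF /=.
  apply/subsetP=> x xT; rewrite -(mem_imset F x (@perm_inj _ s)).
  by apply: (subsetP sTF); exact: imset_f.
case=> F; rewrite inE => /andP[HF sTF] ->; split; first exact: imset_f.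
exact: imsetS.
Qed.

Theorem theorem1p5 (R : realType) (r a t : nat) (p : R)
    (hr : 3 <= r) (ha : 2 <= a) (ht1 : 1 <= t) (htr : t <= r - 1)
    (hp : (1 < p)%R) :
  exists N : nat, forall n : nat, N <= n ->
  forall A : {set 'I_n}, #|A| = a ->
  forall H : {set {set 'I_n}},
    uniform r H -> linear_path_free r (2 * a + 1) H ->
    (tpnorm t p H <= tpnorm t p (meeting_family r A))%R /\
    (tpnorm t p H = tpnorm t p (meeting_family r A) <->
     isomorphic H (meeting_family r A)).
Proof.
have a0 : 0 < a by apply: leq_trans ha.
have tr : t < r by lia.
have [P pP] : exists P : nat, (p <= P%:R)%R.
  by exists (Num.bound p); apply/ltW/archi_boundP; lra.
pose s := r * (2 * a + 1).
pose m := P * 2 ^ r * (r * (2 * a + 1) * (2 * (2 ^ (r - 2) * (r - 2)`!) * r)).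
pose g := 2 * a + m + 1.
have g0 : 0 < g by rewrite /g addn1.
have [N hN] := stability hr a0 ht1 tr hp g0.
exists (N + (2 * (2 ^ (r - 2) * (r - 2)`!) * s + 2 * (r + a))) => n nN A cA H uH fH.
have np : ~ has_path (2 * a + 1) H.
  by apply: linear_path_free_has_path fH => //; apply: leq_trans hr.
have iso_eq : isomorphic H (meeting_family r A) ->
    tpnorm t p H = tpnorm t p (meeting_family r A).
  by case=> w <-; rewrite tpnorm_perm.
have [le|lt] := lerP (tpnorm t p (meeting_family r A)) (tpnorm t p H); last first.
  split; first exact: ltW.
  by split=> // e; move: lt; rewrite e ltxx.
(* [A'] is found from [H] and need not be the given [A], so a permutation has to carry one onto the
   other. *)
have [A' [cA' hA']] := hN n (leq_trans (leq_addr _ _) nN) A H cA uH np le.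
have [w wA] : exists w : {perm 'I_n}, w @: A' = A.
  by apply: exists_perm_imset; rewrite cA cA'.
have eF : [set w @: (E : {set 'I_n}) | E in meeting_family r A'] = meeting_family r A.
  by rewrite meeting_family_perm wA.
have e : tpnorm t p (meeting_family r A') = tpnorm t p (meeting_family r A).
  by rewrite -eF tpnorm_perm.
have ga : 2 * a <= g by rewrite /g -addnA leq_addr.
have gm : m < g by rewrite /g addn1 ltnS leq_addl.
have nN2 := leq_trans (leq_addl _ _) nN.
have [eH|] := near_extremal hp pP ht1 tr uH hr a0 cA' (leqnn s) np hA' ga gm nN2.
  have isoH : isomorphic H (meeting_family r A) by exists w; rewrite eH.
  split; first by rewrite (iso_eq isoH) lexx.
  by split=> _; [exact: isoH | exact: iso_eq].
by rewrite e => lt; move: (lt_le_trans lt le); rewrite ltxx.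
Qed.
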